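(* Let $K$ be a number field and let $b\in K$ with $b\neq 0,-4$. Let $E_b/K$ be the elliptic curve $y^2=(x^2+b)(x+2)$. If $K$ contains $\sqrt{-1}$, then there exist infinitely many linearly disjoint (over $K$) $C_4$-extensions $L_1,L_2,\ldots$ of $K$ such that $\mathrm{rank}\,E_b(L_i)\ge \mathrm{rank}\,E_b(K)+2$ for every $i$.
   Context: $C_4$ is the cyclic group of order 4; a $C_4$-extension of $K$ is a finite Galois extension $L/K$ with Galois group isomorphic to $C_4$. $\mathrm{rank}\,E(L)$ is the rank of the Mordell–Weil group $E(L)$. *)

(* Defs.v *)
From HB Require Import structures.
From mathcomp Require Import all_boot all_order all_algebra all_fingroup all_solvable all_field.
From mathcomp Require Import boolp classical_sets constructive_ereal.
From mathcomp Require Import ring.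

Set Implicit Arguments.
Unset Strict Implicit.
Unset Printing Implicit Defensive.

Import GRing.Theory.
Local Open Scope ring_scope.

Section Curve.

Variables (F : fieldType) (b : F).

(* [None] is the point at infinity; y^2 = (x^2 + b)(x + 2) has Weierstrass
   form y^2 = x^3 + 2 x^2 + b x + 2 b. *)
Definition on_curve (p : option (F * F)) : bool :=
  if p is Some (x, y) then y ^+ 2 == (x ^+ 2 + b) * (x + 2) else true.

(* The set E_b(F). *)
Record ec_point := ECPoint { ec_val : option (F * F); _ : on_curve ec_val }.

HB.instance Definition _ := [isSub for ec_val].

Definition ec_slope (x1 y1 x2 y2 : F) : F :=
  if x1 == x2 then (3 * x1 ^+ 2 + 4 * x1 + b) / (2 * y1)
  else (y2 - y1) / (x2 - x1).

Definition ec_add_val (p q : option (F * F)) : option (F * F) :=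
  match p, q with
  | None, _ => q
  | _, None => p
  | Some (x1, y1), Some (x2, y2) =>
      if (x1 == x2) && (y1 == - y2) then None
      else
        let l := ec_slope x1 y1 x2 y2 in
        let x3 := l ^+ 2 - 2 - x1 - x2 in
        Some (x3, l * (x1 - x3) - y1)
  end.

Definition ec_opp_val (p : option (F * F)) : option (F * F) :=
  if p is Some (x, y) then Some (x, - y) else None.

Lemma ec_opp_on_curve (p : ec_point) : on_curve (ec_opp_val (ec_val p)).
Proof. by case: p => [[[x y]|]] //=; rewrite sqrrN. Qed.

(* [l] is the slope of the line through the two points, and the hypothesis on
   [x2] says that [x2] is a root of (f(x) - (l (x - x1) + y1)^2) / (x - x1),
   where f(x) = (x^2 + b)(x + 2). *)
Lemma ec_third_on_curve (x1 y1 x2 l : F) :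
    y1 ^+ 2 = (x1 ^+ 2 + b) * (x1 + 2) ->
    x2 ^+ 2 + x2 * x1 + x1 ^+ 2 + 2 * (x2 + x1) + b
      - l ^+ 2 * (x2 - x1) - 2 * l * y1 = 0 ->
  let x3 := l ^+ 2 - 2 - x1 - x2 in
  (l * (x1 - x3) - y1) ^+ 2 = (x3 ^+ 2 + b) * (x3 + 2).
Proof.
move=> E1 E2 x3; apply/eqP; rewrite -subr_eq0; apply/eqP.
transitivity ((y1 ^+ 2 - (x1 ^+ 2 + b) * (x1 + 2)) - (x3 - x1) *
   (x2 ^+ 2 + x2 * x1 + x1 ^+ 2 + 2 * (x2 + x1) + b
      - l ^+ 2 * (x2 - x1) - 2 * l * y1)); first by rewrite /x3; ring.
by rewrite E1 E2 subrr mulr0 subr0.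
Qed.

Lemma ec_add_on_curve (p q : ec_point) :
  on_curve (ec_add_val (ec_val p) (ec_val q)).
Proof.
case: p q => [[[x1 y1]|] Hp] [[[x2 y2]|] Hq] //=.
case: ifP => // Hn; move: Hp Hq => /= /eqP E1 /eqP E2.
apply/eqP; apply: ec_third_on_curve => //.
rewrite /ec_slope; case: eqVneq Hn => [E12|Nx] /= Hn.
  have E3 : y1 = y2.
    apply/eqP; rewrite -subr_eq0; move: (subr_sqr y1 y2).
    rewrite E1 E2 E12 subrr => /esym/eqP; rewrite mulf_eq0 => /orP[//|].
    by rewrite (addr_eq0 y1 y2) Hn.
  have N2 : 2 * y1 != 0.
    by rewrite mulr_natl mulr2n {2}E3 (addr_eq0 y1 y2) Hn.
  rewrite -E12; set l := _ / _.
  have El : l * (2 * y1) = 3 * x1 ^+ 2 + 4 * x1 + b by rewrite /l divfK.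
  transitivity (3 * x1 ^+ 2 + 4 * x1 + b - l * (2 * y1)); first by ring.
  by rewrite El subrr.
have N : x2 - x1 != 0 by rewrite subr_eq0 eq_sym.
set l := _ / _.
have El : y2 = l * (x2 - x1) + y1 by rewrite /l divfK // subrK.
apply: (mulfI N); rewrite mulr0.
transitivity (((x2 ^+ 2 + b) * (x2 + 2) - (l * (x2 - x1) + y1) ^+ 2)
  - ((x1 ^+ 2 + b) * (x1 + 2) - y1 ^+ 2)); first by ring.
by rewrite -El -E1 -E2 !subrr.
Qed.

Definition ec_zero : ec_point := @ECPoint None isT.
Definition ec_opp (p : ec_point) : ec_point := ECPoint (ec_opp_on_curve p).
Definition ec_add (p q : ec_point) : ec_point := ECPoint (ec_add_on_curve p q).

Definition ec_zmul (m : int) (p : ec_point) : ec_point :=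
  match m with
  | Posz n => iter n (ec_add p) ec_zero
  | Negz n => ec_opp (iter n.+1 (ec_add p) ec_zero)
  end.

Definition ec_indep (r : nat) (p : 'I_r -> ec_point) : Prop :=
  forall m : 'I_r -> int,
    \big[ec_add/ec_zero]_(i < r) ec_zmul (m i) (p i) = ec_zero ->
    forall i, m i = 0.

Definition is_ec_rank (r : nat) : Prop :=
  (exists p : 'I_r -> ec_point, ec_indep p) /\
  (forall (s : nat) (p : 'I_s -> ec_point), ec_indep p -> (s <= r)%N).

(* The rank of E_b(F) in {0, 1, 2, ...} U {+oo}, i.e., the supremum of the
   sizes of Z-linearly independent families. The value +oo makes the function
   total; over a number field it never occurs, by the Mordell-Weil theorem. *)
Definition ec_rank : \bar int :=
  if pselect (exists r, is_ec_rank r) is left h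
  then (Posz (sval (cid h)))%:E else +oo%E.

End Curve.

Definition is_C4_extension (K : fieldType) (L : splittingFieldType K) : Prop :=
  galois 1 {: L} /\ 'Gal({: L} / 1) \isog Zp 4.

Section LinearDisjointness.

Variable Omega : fieldType.

Definition lin_indep_over (k : set Omega) (n : nat) (a : 'I_n -> Omega) : Prop :=
  forall c : 'I_n -> Omega, (forall j, k (c j)) ->
    \sum_(j < n) c j * a j = 0 -> forall j, c j = 0.

(* For subfields k <= A, B of Omega. *)
Definition linearly_disjoint (k A B : set Omega) : Prop :=
  forall (n : nat) (a : 'I_n -> Omega), (forall j, A (a j)) ->
    lin_indep_over k a -> lin_indep_over B a.

Definition generated_subfield (X : set Omega) : set Omega :=
  [set x | forall S : {pred Omega}, divring_closed S ->
             (forall y, X y -> y \in S) -> x \in S]%classic.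

(* A sequence of extensions A_0, A_1, ... of k is linearly disjoint over k when
   each A_n is linearly disjoint from the compositum k A_0 ... A_(n-1). *)
Definition linearly_disjoint_seq (k : set Omega) (A : nat -> set Omega) : Prop :=
  forall n, linearly_disjoint k (A n)
    (generated_subfield
       (k `|` [set x | exists i, (i < n)%N /\ A i x])%classic).

End LinearDisjointness.

(* Main.v *)
(** If v is not a square in K, put g = v^2 + (2 + b) v + 1, let z^4 = v g^2 and
    w = z^2 / g, so that w^2 = v.  As K contains i = sqrt(-1), L = K(z) is a
    C4-extension of K, with generator tau : z |-> i z, and
    P = (w + 1/w, (1 + w) z / w^2) is a point of E_b(L) with tau^2 P = - P.
    If P has infinite order, then P and tau P are independent of each other and
    of E_b(K).

    P has infinite order when v is 2-adically close to 0: by the duplication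
    formula 1/x(2 Q) is 4/x(Q) times a 2-adic unit when 1/x(Q) is 2-adically
    small, so the points 2^k P are pairwise distinct.

    L is linearly disjoint from a number field N containing K as soon as v is
    not a square in N.  Since N has finite degree, some prime p is not a square
    in N, and v = p 4^(k+1) meets both requirements for k large.

    The group axioms are obtained by mapping a point to the class of its
    maximal ideal in the coordinate ring F[X, Y] / (Y^2 - f(X)). *)

Require Import Defs.
From HB Require Import structures.
From mathcomp Require Import all_boot all_order all_algebra all_fingroup all_solvable all_field.
From mathcomp Require Import boolp classical_sets constructive_ereal.
From mathcomp Require Import ring.

Set Implicit Arguments.
Unset Strict Implicit.
Unset Printing Implicit Defensive.

Import Num.Theory GRing.Theory.
Local Open Scope ring_scope.

(** * Ideals and their classes *)

Section Ideals.

Variable R : comNzRingType.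
Implicit Types (I J M S : set R) (a c h l q x y z : R).

Local Open Scope classical_set_scope.

Definition ideal I : Prop := I 0 /\ forall a x y, I x -> I y -> I (a * x + y).

Lemma idealD I x y : ideal I -> I x -> I y -> I (x + y).
Proof. by case=> _ ID Ix Iy; rewrite -[x]mul1r; apply: ID. Qed.

Lemma idealMl I a x : ideal I -> I x -> I (a * x).
Proof. by case=> I0 ID Ix; rewrite -[a * x]addr0; apply: ID. Qed.

Definition ideal_colon I c : set R := [set r | I (c * r)].

Lemma ideal_colon_ideal I c : ideal I -> ideal (ideal_colon I c).
Proof.
move=> [I0 ID]; split=> [|a x y Ix Iy]; rewrite /ideal_colon /= ?mulr0 //.
by rewrite mulrDr mulrCA; apply: ID.
Qed.

Definition ideal_gen S : set R := smallest ideal S.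

Lemma ideal_gen_ideal S : ideal (ideal_gen S).
Proof.
split=> [J [[J0 _] _] //|a x y Sx Sy J [idJ SJ]].
by apply: idJ.2; [apply: Sx | apply: Sy].
Qed.

Definition ideal_mul I J : set R := ideal_gen [set x * y | x in I & y in J].

Lemma ideal_mul_ideal I J : ideal (ideal_mul I J).
Proof. exact: ideal_gen_ideal. Qed.

Lemma mem_ideal_mul I J x y : I x -> J y -> ideal_mul I J (x * y).
Proof. by move=> Ix Jy; apply: sub_gen_smallest; exists x => //; exists y. Qed.

Lemma ideal_mul_sub I J M : ideal M ->
  (forall x y, I x -> J y -> M (x * y)) -> ideal_mul I J `<=` M.
Proof.
by move=> idM IJM; apply: smallest_sub => // _ [x Ix [y Jy <-]]; apply: IJM.
Qed.

Lemma ideal_mulC I J : ideal_mul I J = ideal_mul J I.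
Proof.
apply/seteqP; split; apply: ideal_mul_sub => [|x y Ix Jy];
  do ?exact: ideal_mul_ideal; by rewrite mulrC; apply: mem_ideal_mul.
Qed.

Lemma ideal_mul_genl S J : ideal_mul (ideal_gen S) J = ideal_mul S J.
Proof.
have idSJ := ideal_mul_ideal; apply/seteqP; split; apply: ideal_mul_sub => //.
  move=> x y Sx Jy; rewrite mulrC.
  apply: (smallest_sub (ideal_colon_ideal y (idSJ S J)) _ Sx) => z Sz.
  by rewrite /ideal_colon /= mulrC; apply: mem_ideal_mul.
by move=> x y Sx Jy; apply: mem_ideal_mul => //; apply: sub_gen_smallest.
Qed.

Lemma ideal_mul_genr I S : ideal_mul I (ideal_gen S) = ideal_mul I S.
Proof. by rewrite ideal_mulC ideal_mul_genl ideal_mulC. Qed.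

Lemma ideal_mulA I J M :
  ideal_mul I (ideal_mul J M) = ideal_mul (ideal_mul I J) M.
Proof.
rewrite -[ideal_mul J M]/(ideal_gen _) -[ideal_mul I J]/(ideal_gen _).
rewrite ideal_mul_genr ideal_mul_genl.
congr ideal_gen; apply/seteqP; split=> t /=.
  move=> [x Ix [yz [y Jy [z Mz <-]] <-]]; exists (x * y); last first.
    by exists z => //; rewrite mulrA.
  by exists x => //; exists y.
move=> [xy [x Ix [y Jy <-]] [z Mz <-]]; exists x => //; exists (y * z).
  by exists y => //; exists z.
by rewrite mulrA.
Qed.

Definition principal x : set R := ideal_gen [set x].

Lemma principalP x y : principal x y <-> exists a, y = a * x.
Proof.
split=> [|[a ->]]; last first.
  by apply: (idealMl _ (ideal_gen_ideal _)); apply: sub_gen_smallest.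
apply: (smallest_sub (X := [set z | exists a, z = a * x])) => /=.
  split=> [|a _ _ [s ->] [t ->]]; first by exists 0; rewrite mul0r.
  by exists (a * s + t); ring.
by move=> _ ->; exists 1; rewrite mul1r.
Qed.

Lemma principal_mul x y :
  ideal_mul (principal x) (principal y) = principal (x * y).
Proof.
rewrite ideal_mul_genl ideal_mul_genr /ideal_mul; congr ideal_gen.
apply/seteqP; split=> t /=; first by move=> [_ -> [_ -> <-]].
by move=> ->; exists x => //; exists y.
Qed.

Lemma principal_mulP x I y : ideal I ->
  ideal_mul (principal x) I y -> exists2 g, I g & y = x * g.
Proof.
move=> [I0 ID]; rewrite ideal_mul_genl.
apply: (ideal_mul_sub (M := [set z | exists2 g, I g & z = x * g])) => /=.
  split=> [|a _ _ [g Ig ->] [h Ih ->]]; first by exists 0; rewrite ?mulr0.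
  by exists (a * g + h); [apply: ID | ring].
by move=> _ g -> Ig; exists g.
Qed.

Lemma ideal_mul1 I : ideal I -> ideal_mul (principal 1) I = I.
Proof.
move=> idI; apply/seteqP; split=> x.
  by move=> /(principal_mulP idI)[g Ig ->]; rewrite mul1r.
move=> Ix; rewrite -[x]mul1r; apply: mem_ideal_mul => //.
exact: sub_gen_smallest.
Qed.

Lemma eq_principal I x :
  ideal I -> I x -> I `<=` principal x -> I = principal x.
Proof.
move=> idI Ix subI; apply/seteqP; split=> // _ /principalP[a ->].
exact: idealMl.
Qed.

Lemma mem_ideal_comaximal S I c : ideal_gen S 1 -> ideal I ->
  (forall x, S x -> I (c * x)) -> I c.
Proof.
move=> one idI cS; rewrite -[c]mulr1.
exact: (smallest_sub (ideal_colon_ideal c idI) cS).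
Qed.

Definition ideal2 x y : set R := ideal_gen [set x; y].

Lemma mem_ideal2l x y : ideal2 x y x.
Proof. by apply: sub_gen_smallest; left. Qed.

Lemma mem_ideal2r x y : ideal2 x y y.
Proof. by apply: sub_gen_smallest; right. Qed.

#[local] Hint Resolve mem_ideal2l mem_ideal2r : core.

Lemma ideal2P x y z : ideal2 x y z -> exists s t, z = s * x + t * y.
Proof.
apply: (smallest_sub (X := [set z | exists s t, z = s * x + t * y])) => /=.
  split=> [|a _ _ [s [t ->]] [s' [t' ->]]]; first by exists 0, 0; ring.
  by exists (a * s + s'), (a * t + t'); ring.
by move=> _ [] ->; [exists 1, 0 | exists 0, 1]; ring.
Qed.

Lemma ideal2_addMr x y a : ideal2 x (y + a * x) = ideal2 x y.
Proof.
have id2 z : ideal (ideal2 x z) by exact: ideal_gen_ideal.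
apply/seteqP; split; apply: smallest_sub (id2 _) _ => _ [] -> //.
  by apply: (idealD (id2 _)) => //; apply: (idealMl _ (id2 _)).
have {2}-> : y = - a * x + (y + a * x) by ring.
by apply: (idealD (id2 _)) => //; apply: (idealMl _ (id2 _)).
Qed.

Lemma ideal2_mul_conj c l l' q : l * l' = c * q ->
    ideal_gen [set c; l; l'; q] 1 ->
  ideal_mul (ideal2 c l) (ideal2 c l') = principal c.
Proof.
move=> Ell' one; have idI := ideal_mul_ideal (ideal2 c l) (ideal2 c l').
apply: eq_principal => //.
  apply: (mem_ideal_comaximal one idI) => _ [[[]|]|] ->; last rewrite -Ell'.
  - exact: mem_ideal_mul.
  - by rewrite mulrC; apply: mem_ideal_mul.
  - exact: mem_ideal_mul.
  - exact: mem_ideal_mul.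
rewrite ideal_mul_genl ideal_mul_genr.
apply: ideal_mul_sub (ideal_gen_ideal _) _ => _ _ [] -> [] ->; apply/principalP.
- by exists c.
- by exists l'; rewrite mulrC.
- by exists l.
- by exists q; rewrite Ell' mulrC.
Qed.

Lemma ideal2_mul_line c1 c2 c3 l l' : c1 * c2 * c3 = l * l' ->
    ideal_gen [set c1 * c2; c1 * c3; c2 * c3; l * l; l'] 1 ->
  ideal_mul (ideal_mul (ideal2 c1 l) (ideal2 c2 l)) (ideal2 c3 l) = principal l.
Proof.
move=> Ec one; set I := ideal_mul _ _.
have idI : ideal I by exact: ideal_mul_ideal.
have memI x1 x2 x3 : ideal2 c1 l x1 -> ideal2 c2 l x2 -> ideal2 c3 l x3 ->
    I (x1 * x2 * x3).
  by move=> I1 I2 I3; apply: mem_ideal_mul => //; apply: mem_ideal_mul.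
apply: eq_principal => //.
  apply: (mem_ideal_comaximal one idI) => _ [[[[]|]|]|] ->; last rewrite -Ec.
  - by rewrite mulrC; apply: memI.
  - by rewrite mulrCA mulrA; apply: memI.
  - by rewrite mulrA; apply: memI.
  - by rewrite mulrA; apply: memI.
  - exact: memI.
rewrite /I ideal_mul_genr [ideal_mul (ideal2 c1 l) _]ideal_mul_genl.
rewrite ideal_mul_genr ideal_mul_genl.
apply: ideal_mul_sub (ideal_gen_ideal _) _ => x12 x3 [x1 Sx1 [x2 Sx2 <-]] Sx3.
apply/principalP; case: Sx3 => ->; last by exists (x1 * x2).
case: Sx2 => ->; last by exists (x1 * c3); ring.
case: Sx1 => ->; last by exists (c2 * c3); ring.
by exists l'; rewrite Ec mulrC.
Qed.

Definition ideal_equiv I J : Prop := exists h k, [/\ GRing.lreg h, GRing.lreg k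
  & ideal_mul (principal h) I = ideal_mul (principal k) J].

Lemma ideal_equiv_refl I : ideal_equiv I I.
Proof. by exists 1, 1; split=> //; apply: lreg1. Qed.

Lemma ideal_equiv_sym I J : ideal_equiv I J -> ideal_equiv J I.
Proof. by move=> [h [k [reg_h reg_k E]]]; exists k, h. Qed.

Lemma ideal_equiv_trans J I M :
  ideal_equiv I J -> ideal_equiv J M -> ideal_equiv I M.
Proof.
move=> [h [k [reg_h reg_k E]]] [h' [k' [reg_h' reg_k' E']]].
exists (h' * h), (k * k'); split; [exact: lregM | exact: lregM |].
rewrite -!principal_mul -!ideal_mulA E -E' !ideal_mulA.
by congr ideal_mul; rewrite ideal_mulC.
Qed.

Lemma ideal_equiv_mulr I J M :
  ideal_equiv I J -> ideal_equiv (ideal_mul I M) (ideal_mul J M).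
Proof.
by move=> [h [k [reg_h reg_k E]]]; exists h, k; rewrite !ideal_mulA E.
Qed.

Lemma ideal_equiv_mull I J M :
  ideal_equiv I J -> ideal_equiv (ideal_mul M I) (ideal_mul M J).
Proof. by rewrite !(ideal_mulC M); apply: ideal_equiv_mulr. Qed.

Lemma ideal_equiv_cancel I J M : ideal I -> ideal J ->
    ideal_equiv (ideal_mul I M) (principal 1) ->
    ideal_equiv (ideal_mul J M) (principal 1) -> ideal_equiv I J.
Proof.
move=> idI idJ IM JM; apply: (@ideal_equiv_trans (ideal_mul I (ideal_mul J M))).
  rewrite -{1}(ideal_mul1 idI) ideal_mulC.
  exact/ideal_equiv_mull/ideal_equiv_sym.
rewrite (ideal_mulC J) ideal_mulA -{2}(ideal_mul1 idJ).
exact: ideal_equiv_mulr.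
Qed.

Lemma ideal_equiv_principal h :
  GRing.lreg h -> ideal_equiv (principal h) (principal 1).
Proof.
move=> reg_h; exists 1, h; split=> //; first exact: lreg1.
by rewrite !principal_mul mulrC.
Qed.

Lemma ideal_equiv1_principal I : ideal I -> ideal_equiv I (principal 1) ->
  exists g, I = principal g.
Proof.
move=> idI [h [k [reg_h _]]]; rewrite principal_mul mulr1 => E.
have [|g Ig Ek] := principal_mulP idI (x := h) (y := k).
  by rewrite E; apply: sub_gen_smallest.
exists g; apply: eq_principal => // x Ix; apply/principalP.
have /principalP[a Ea] : principal k (h * x).
  by rewrite -E; apply: mem_ideal_mul => //; apply: sub_gen_smallest.
by exists a; apply: reg_h; rewrite Ea Ek; ring.
Qed.

End Ideals.

(** * The coordinate ring of y^2 = f(x) *)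

Section CoordinateRing.

Variable F : fieldType.

(* The pair (a, c) stands for a(X) + c(X) Y in F[X, Y] / (Y^2 - f(X)). *)
Definition coord_ring (f : {poly F}) : Type := ({poly F} * {poly F})%type.

Variable f : {poly F}.
Local Notation R := (coord_ring f).
Implicit Types (g h : R) (m : {poly F}) (x y : F).

HB.instance Definition _ := GRing.Zmodule.on R.

Definition coord_mul g h : R :=
  (g.1 * h.1 + g.2 * h.2 * f, g.1 * h.2 + g.2 * h.1).

Fact coord_mulA : associative coord_mul.
Proof. by move=> g h k; congr (_, _) => /=; ring. Qed.
Fact coord_mulC : commutative coord_mul.
Proof. by move=> g h; congr (_, _) => /=; ring. Qed.
Fact coord_mul1 : left_id ((1, 0) : R) coord_mul.
Proof. by move=> [a c]; congr (_, _) => /=; ring. Qed.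
Fact coord_mulD : left_distributive coord_mul +%R.
Proof. by move=> g h k; congr (_, _) => /=; ring. Qed.
Fact coord_1neq0 : ((1, 0) : R) != 0.
Proof. by apply/eqP=> -[] /eqP; rewrite oner_eq0. Qed.

HB.instance Definition _ := GRing.Zmodule_isComNzRing.Build R
  coord_mulA coord_mulC coord_mul1 coord_mulD coord_1neq0.

Lemma coord_mulE g h : g * h = coord_mul g h. Proof. by []. Qed.

Definition coord_poly (a : {poly F}) : R := (a, 0).
Definition coord_y : R := (0, 1).

Fact coord_poly_zmod_morphism : zmod_morphism coord_poly.
Proof. by move=> a c; congr (_, _); rewrite /= ?subr0. Qed.
Fact coord_poly_monoid_morphism : monoid_morphism coord_poly.
Proof. by split=> // a c; rewrite coord_mulE; congr (_, _) => /=; ring. Qed.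

HB.instance Definition _ :=
  GRing.isZmodMorphism.Build _ _ coord_poly coord_poly_zmod_morphism.
HB.instance Definition _ :=
  GRing.isMonoidMorphism.Build _ _ coord_poly coord_poly_monoid_morphism.

Local Notation cX := coord_poly.
Local Notation cY := coord_y.

Lemma coord_y_sqr : cY * cY = cX f.
Proof. by rewrite coord_mulE; congr (_, _) => /=; ring. Qed.

Definition coord_norm g : {poly F} := g.1 ^+ 2 - g.2 ^+ 2 * f.

Lemma coord_normM g h : coord_norm (g * h) = coord_norm g * coord_norm h.
Proof. by rewrite coord_mulE /coord_norm /=; ring. Qed.

Hypothesis f_odd_degree : (3 < size f)%N && ~~ odd (size f).

(* deg (a^2) is even while deg (c^2 f) is odd, so the two do not cancel. *)
Lemma size_coord_norm g : g.2 != 0 -> (3 < size (coord_norm g))%N.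
Proof.
have [f_gt3 f_even] := andP f_odd_degree.
have sqr_size (a : {poly F}) : a != 0 -> size (a ^+ 2) = (size a).*2.-1.
  by move=> a0; rewrite expr2 size_mul // addnn.
case: g => a c /= c0; rewrite /coord_norm /=.
have f0 : f != 0 by rewrite -size_poly_gt0 (ltn_trans _ f_gt3).
have c_gt0 : (0 < size c)%N by rewrite size_poly_gt0.
have size_c2f : size (c ^+ 2 * f) = ((size c).*2.-2 + size f)%N.
  by rewrite size_mul ?expf_neq0 // sqr_size //; case: (size c) c_gt0.
have [->|a0] := eqVneq a 0.
  by rewrite expr0n /= sub0r size_polyN size_c2f ltn_addl.
have a_gt0 : (0 < size a)%N by rewrite size_poly_gt0.
have [lt|lt|E] := ltngtP (size (a ^+ 2)) (size (c ^+ 2 * f)).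
- by rewrite addrC size_polyDl ?size_polyN // size_c2f ltn_addl.
- by rewrite size_polyDl ?size_polyN // (ltn_trans _ lt) // size_c2f ltn_addl.
- move: E f_even; rewrite size_c2f sqr_size //.
  by case: (size a) (size c) a_gt0 c_gt0 => [|n] [|k] //= _ _ /(congr1 odd);
    rewrite /= oddD !odd_double /= => <-.
Qed.

Lemma coord_norm_eq0 g : (coord_norm g == 0) = (g == 0).
Proof.
apply/eqP/eqP=> [N0|->]; last by rewrite /coord_norm expr0n mul0r subrr.
have [c0|/size_coord_norm] := eqVneq g.2 0; last by rewrite N0 size_poly0.
move: N0; rewrite /coord_norm c0 expr0n mul0r subr0 => /eqP.
by rewrite sqrf_eq0 => /eqP a0; case: g a0 c0 => a c /= -> ->.
Qed.

Lemma coord_lreg g : g != 0 -> GRing.lreg g.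
Proof.
move=> g0; apply: mulrI0_lreg => h /eqP; rewrite -coord_norm_eq0 coord_normM.
by rewrite mulf_eq0 !coord_norm_eq0 (negbTE g0) => /eqP.
Qed.

Definition point_ideal x y : set R :=
  ideal2 (cX ('X - x%:P)) (cY - cX y%:P).

Lemma point_ideal_ideal x y : ideal (point_ideal x y).
Proof. exact: ideal_gen_ideal. Qed.

Lemma point_ideal_graph x m :
  point_ideal x m.[x] = ideal2 (cX ('X - x%:P)) (cY - cX m).
Proof.
have /factor_theorem[q Em] : root (m - m.[x]%:P) x.
  by rewrite /root !hornerE subrr.
rewrite -(ideal2_addMr _ _ (cX q)); congr ideal2.
by rewrite -rmorphM -Em; ring.
Qed.

Lemma point_ideal_vanish x y g : y ^+ 2 = f.[x] -> point_ideal x y g ->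
  g.1.[x] + g.2.[x] * y = 0.
Proof.
move=> on_fxy /ideal2P[s [t ->]]; rewrite !coord_mulE /=.
by rewrite !hornerE /= -on_fxy; ring.
Qed.

(* A generator g would have a norm dividing the norm (X - x)^2 of X - x, hence
   lie in F[X]; it would then be a unit, as it divides Y - y. *)
Lemma point_ideal_nprincipal x y : y ^+ 2 = f.[x] ->
  ~ ideal_equiv (point_ideal x y) (principal 1).
Proof.
move=> on_fxy /(ideal_equiv1_principal (@point_ideal_ideal x y))[g Eg].
have /principalP[s Es] : principal g (cX ('X - x%:P)).
  by rewrite -Eg; apply: mem_ideal2l.
have /principalP[t Et] : principal g (cY - cX y%:P).
  by rewrite -Eg; apply: mem_ideal2r.
have Ig : point_ideal x y g by rewrite Eg; apply: sub_gen_smallest.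
have norm_g : coord_norm s * coord_norm g = ('X - x%:P) ^+ 2.
  by rewrite -coord_normM -Es /coord_norm /= expr0n /= mul0r subr0.
have g2 : g.2 = 0.
  apply/eqP; apply: contraT => /size_coord_norm.
  have /dvdp_leq : coord_norm g %| ('X - x%:P) ^+ 2.
    by rewrite -norm_g dvdp_mull.
  rewrite expf_neq0 ?polyXsubC_eq0 // size_exp_XsubC => /(_ isT) size_le3.
  by rewrite ltnNge size_le3.
have unit_g : t.2 * g.1 = 1.
  move: Et; rewrite coord_mulE => /(congr1 snd) /=.
  by rewrite g2 mulr0 add0r subr0.
have := point_ideal_vanish on_fxy Ig; rewrite g2 horner0 mul0r addr0 => gx.
have /(congr1 (horner^~ x)) := unit_g; rewrite hornerM gx mulr0 hornerC.
by move/esym/eqP; rewrite oner_eq0.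
Qed.

Hypothesis two_neq0 : 2 != 0 :> F.
Hypothesis f_sep : separable_poly f.

(* The Jacobian criterion: y^2 = f(x) has no point with 2 y = f'(x) = 0. *)
Lemma coord_jacobian (I : set R) : ideal I ->
  I (4 * cX f) -> I (cX f^`() * cX f^`()) -> I 1.
Proof.
move=> idI If Id; move: f_sep; rewrite unlock.
move=> /Bezout_eq1_coprimepP[[u v] /= uv].
have uvX : cX u * cX f + cX v * cX f^`() = 1.
  by rewrite -!rmorphM -rmorphD uv rmorph1.
have inv4 : cX (4^-1)%:P * 4 = 1.
  have -> : (4 : R) = cX 4%:P by rewrite !rmorph_nat.
  rewrite -!rmorphM /= mulVf ?rmorph1 //.
  by rewrite (_ : 4 = 2 * 2) ?mulf_neq0 // -natrM.
have -> : 1 = cX (4^-1)%:P * (cX u * cX u * cX f + 2 * cX u * cX v * cX f^`())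
   * (4 * cX f) + cX v * cX v * (cX f^`() * cX f^`()).
  transitivity ((cX u * cX f + cX v * cX f^`()) ^+ 2).
    by rewrite uvX expr1n.
  set e := cX (4^-1)%:P in inv4 *.
  transitivity (e * 4 * (cX u * cX u * cX f + 2 * cX u * cX v * cX f^`())
    * cX f + cX v * cX v * (cX f^`() * cX f^`())); last by ring.
  by rewrite inv4; ring.
by apply: (idealD idI); apply: (idealMl _ idI).
Qed.

Lemma point_ideal_opp x y : y ^+ 2 = f.[x] ->
  ideal_mul (point_ideal x y) (point_ideal x (- y)) =
    principal (cX ('X - x%:P)).
Proof.
move=> on_fxy; have /factor_theorem[q Ef] : root (f - (y ^+ 2)%:P) x.
  by rewrite /root !hornerE on_fxy subrr.
set c := 'X - x%:P in Ef *.
have {}Ef : f = q * c + y%:P * y%:P by rewrite -polyCM -expr2 -Ef subrK.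
apply: (@ideal2_mul_conj _ _ _ _ (cX q)).
  transitivity (cY * cY - cX (y%:P * y%:P)); first by rewrite polyCN; ring.
  have EcX : cX f = cX (q * c + y%:P * y%:P) by rewrite -Ef.
  by rewrite coord_y_sqr EcX /c; ring.
set S := [set _; _; _; _]%classic; have idS := ideal_gen_ideal S.
have genS g : S g -> ideal_gen S g by apply: sub_gen_smallest.
have mulS h g : S g -> ideal_gen S (h * g) by move/genS; apply: idealMl.
have [Sc Sl Sl' Sq] :
    [/\ S (cX c), S (cY - cX y%:P), S (cY - cX (- y)%:P) & S (cX q)].
  by split; [left; left; left | left; left; right | left; right | right].
apply: (coord_jacobian idS) => //.
  have -> : 4 * cX f = 2 * cY * (cY - cX y%:P) + 2 * cY * (cY - cX (- y)%:P).
    by rewrite -coord_y_sqr polyCN; ring.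
  by apply: (idealD idS); apply: mulS.
apply: (idealMl _ idS).
have -> : cX f^`() = cX q + cX q^`() * cX c.
  have -> : f^`() = q + q^`() * c.
    by rewrite {1}Ef derivD !derivM derivXsubC derivC; ring.
  by ring.
by apply: (idealD idS); [apply: genS | apply: mulS].
Qed.

Lemma point_ideal_line x1 x2 x3 m :
    ('X - x1%:P) * ('X - x2%:P) * ('X - x3%:P) = f - m ^+ 2 ->
  ideal_mul (ideal_mul (point_ideal x1 m.[x1]) (point_ideal x2 m.[x2]))
    (point_ideal x3 m.[x3]) = principal (cY - cX m).
Proof.
rewrite !point_ideal_graph.
set c1 := 'X - x1%:P; set c2 := 'X - x2%:P; set c3 := 'X - x3%:P => Ec.
apply: (@ideal2_mul_line _ _ _ _ _ (cY + cX m)).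
  transitivity (cX (f - m ^+ 2)); first by rewrite -Ec; ring.
  by rewrite rmorphB /= -coord_y_sqr; ring.
set l := cY - cX m; set S := [set _; _; _; _; _]%classic.
have idS := ideal_gen_ideal S.
have genS g : S g -> ideal_gen S g by apply: sub_gen_smallest.
have mulS h g : S g -> ideal_gen S (h * g) by move/genS; apply: idealMl.
have [S12 S13 S23] :
    [/\ S (cX c1 * cX c2), S (cX c1 * cX c3) & S (cX c2 * cX c3)].
  by split; do 2?left; [left; left | left; right | right].
have [Sll Sl'] : S (l * l) /\ S (cY + cX m) by split; [left; right | right].
have I4f : ideal_gen S (4 * cX f).
  have -> : 4 * cX f = l * l + (3 * cY - cX m) * (cY + cX m).
    by rewrite -coord_y_sqr /l; ring.
  by apply: (idealD idS); [apply: genS | apply: mulS].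
(* Differentiate c1 c2 c3 = f - m^2. *)
have If' : ideal_gen S (cX f^`() + 2 * cX m^`() * cY).
  have -> : cX f^`() + 2 * cX m^`() * cY = 2 * cX m^`() * (cY + cX m) +
     cX c1 * cX c2 + cX c1 * cX c3 + cX c2 * cX c3.
    have -> : f^`() = c1 * c2 + c1 * c3 + c2 * c3 + (m * m^`() + m * m^`()).
      rewrite -[f](subrK (m ^+ 2)) -Ec derivD expr2 !derivM !derivXsubC.
      by rewrite -/c1 -/c2 -/c3; ring.
    by ring.
  do 2![apply: (idealD idS); last exact: genS].
  by apply: (idealD idS); [apply: mulS | apply: genS].
apply: (coord_jacobian idS) => //.
have -> : cX f^`() * cX f^`() = (cX f^`() - 2 * cX m^`() * cY) *
   (cX f^`() + 2 * cX m^`() * cY) + cX m^`() * cX m^`() * (4 * cX f).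
  by rewrite -coord_y_sqr; ring.
by apply: (idealD idS); apply: (idealMl _ idS).
Qed.

End CoordinateRing.

Arguments point_ideal {F} f x y.

(** * The group law *)

Definition ec_smooth (F : fieldType) (b : F) : bool := 2 * b * (b + 4) != 0.

Section GroupLaw.

Variables (F : fieldType) (b : F).
Implicit Types (x y l : F) (p q r : ec_point b).

Definition ec_poly : {poly F} := ('X ^+ 2 + b%:P) * ('X + 2%:P).

Lemma size_ec_poly : size ec_poly = 4.
Proof. by rewrite size_mul -?size_poly_eq0 ?size_XaddC ?size_XnaddC. Qed.

Lemma ec_poly_horner x : ec_poly.[x] = (x ^+ 2 + b) * (x + 2).
Proof. by rewrite /ec_poly !hornerE. Qed.

Lemma ec_smoothP : reflect [/\ 2 != 0 :> F, b != 0 & b + 4 != 0] (ec_smooth b).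
Proof. by rewrite /ec_smooth !mulf_eq0 !negb_or -andbA; apply: and3P. Qed.

Lemma ec_poly_separable : ec_smooth b -> separable_poly ec_poly.
Proof.
move=> /ec_smoothP[n2 b0 b4]; rewrite separable_mul; apply/and3P; split.
- rewrite unlock derivD derivXn derivC addr0 -scaler_nat coprimepZr //.
  by rewrite coprimepX /root !hornerE expr0n add0r.
- by rewrite unlock derivD derivX derivC addr0 coprimep1.
- rewrite -[2%:P]opprK -polyCN coprimep_XsubC /root !hornerE sqrrN.
  by rewrite -natrX addrC.
Qed.

(* For (x1, y1) on the curve f = y^2, this is
   (f(x) - (l (x - x1) + y1)^2) / (x - x1). *)
Definition ec_chord_quotient x1 y1 l x : F :=
  x ^+ 2 + x * x1 + x1 ^+ 2 + 2 * (x + x1) + b - l ^+ 2 * (x - x1) - 2 * l * y1.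

Lemma ec_chord_factor x1 y1 x2 l (x3 := l ^+ 2 - 2 - x1 - x2)
    (m := l%:P * ('X - x1%:P) + y1%:P) :
    y1 ^+ 2 = (x1 ^+ 2 + b) * (x1 + 2) -> ec_chord_quotient x1 y1 l x2 = 0 ->
  ('X - x1%:P) * ('X - x2%:P) * ('X - x3%:P) = ec_poly - m ^+ 2.
Proof.
move=> /(congr1 polyC) on1 /(congr1 polyC) quot0.
apply/eqP; rewrite -subr_eq0; apply/eqP.
transitivity ((y1 ^+ 2)%:P - ((x1 ^+ 2 + b) * (x1 + 2))%:P - ('X - x1%:P) *
  (ec_chord_quotient x1 y1 l x2)%:P).
  by rewrite /ec_chord_quotient /x3 /m /ec_poly; ring.
by rewrite on1 quot0 subrr mulr0 subr0.
Qed.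

Lemma eq_of_sqr_nopp (y1 y2 : F) :
  y1 ^+ 2 = y2 ^+ 2 -> y1 != - y2 -> y1 = y2 /\ 2 * y1 != 0.
Proof.
move=> /eqP; rewrite eqf_sqr => /orP[/eqP <-|-> //] nopp.
by split=> //; rewrite mulr_natl mulr2n addr_eq0.
Qed.

Lemma ec_slope_chord x1 y1 x2 y2 (l := ec_slope b x1 y1 x2 y2) :
    y1 ^+ 2 = (x1 ^+ 2 + b) * (x1 + 2) -> y2 ^+ 2 = (x2 ^+ 2 + b) * (x2 + 2) ->
    ~~ ((x1 == x2) && (y1 == - y2)) ->
  y2 = l * (x2 - x1) + y1 /\ ec_chord_quotient x1 y1 l x2 = 0.
Proof.
rewrite /l /ec_slope /ec_chord_quotient => on1 on2.
case: eqVneq on2 => [<-|x12] /= on2 nopp.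
  have [|<- y1_neq0] := eq_of_sqr_nopp _ nopp; first by rewrite on1 on2.
  split; first by ring.
  by move: y1_neq0; rewrite mulf_eq0 negb_or => /andP[n2 y0]; field; apply/andP.
have {}x12 : x2 - x1 != 0 by rewrite subr_eq0 eq_sym.
set l' := _ / _.
have Ey2 : y2 = l' * (x2 - x1) + y1 by rewrite /l' divfK // subrK.
split=> //; apply: (mulfI x12); rewrite mulr0.
transitivity (((x2 ^+ 2 + b) * (x2 + 2) - (l' * (x2 - x1) + y1) ^+ 2)
  - ((x1 ^+ 2 + b) * (x1 + 2) - y1 ^+ 2)); first by ring.
by rewrite -Ey2 -on1 -on2 !subrr.
Qed.

Definition point_class p : set (coord_ring ec_poly) :=
  if ec_val p is Some (x, y) then point_ideal ec_poly x y else principal 1.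

Lemma point_class_ideal p : ideal (point_class p).
Proof.
by rewrite /point_class; case: (ec_val p) => [[x y]|]; apply: ideal_gen_ideal.
Qed.

Lemma ec_add0 : left_id (ec_zero b) (@ec_add F b).
Proof. by move=> p; apply: val_inj. Qed.

Lemma ec_addN : left_inverse (ec_zero b) (@ec_opp F b) (@ec_add F b).
Proof. by move=> [[[x y]|]] on_xy; apply: val_inj; rewrite //= !eqxx. Qed.

Hypothesis b_smooth : ec_smooth b.

Let ec_poly_odd : (3 < size ec_poly)%N && ~~ odd (size ec_poly).
Proof. by rewrite size_ec_poly. Qed.

Lemma point_class_opp p :
  ideal_equiv (ideal_mul (point_class p) (point_class (ec_opp p)))
    (principal 1).
Proof.
have [n2 _ _] := ec_smoothP b_smooth.
case: p => [[[x y]|]]; last first.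
  by rewrite /point_class /= principal_mul mulr1 => _; apply: ideal_equiv_refl.
rewrite /point_class /= => /eqP on_xy.
rewrite point_ideal_opp ?ec_poly_horner ?ec_poly_separable //.
apply/ideal_equiv_principal/coord_lreg => //.
by apply/eqP=> -[/eqP]; rewrite polyXsubC_eq0.
Qed.

Lemma point_class_chord x1 y1 x2 y2 (l := ec_slope b x1 y1 x2 y2)
    (x3 := l ^+ 2 - 2 - x1 - x2) :
    y1 ^+ 2 = (x1 ^+ 2 + b) * (x1 + 2) -> y2 ^+ 2 = (x2 ^+ 2 + b) * (x2 + 2) ->
    ~~ ((x1 == x2) && (y1 == - y2)) ->
  ideal_equiv (ideal_mul
      (ideal_mul (point_ideal ec_poly x1 y1) (point_ideal ec_poly x2 y2))
      (point_ideal ec_poly x3 (- (l * (x1 - x3) - y1))))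
    (principal 1).
Proof.
have [n2 _ _] := ec_smoothP b_smooth => on1 on2 nopp.
have [Ey2 quot0] := ec_slope_chord on1 on2 nopp.
pose m := l%:P * ('X - x1%:P) + y1%:P.
have -> : y1 = m.[x1] by rewrite /m !hornerE; ring.
have -> : y2 = m.[x2] by rewrite /m !hornerE -Ey2.
have -> : - (l * (x1 - x3) - m.[x1]) = m.[x3] by rewrite /m !hornerE; ring.
rewrite point_ideal_line ?ec_poly_separable //; last exact: ec_chord_factor.
apply/ideal_equiv_principal/coord_lreg => //.
by apply/eqP=> /(congr1 snd)/eqP; rewrite /= subr0 oner_eq0.
Qed.

Lemma point_class_collinear p q :
  ideal_equiv (ideal_mul (ideal_mul (point_class p) (point_class q))
    (point_class (ec_opp (ec_add p q)))) (principal 1).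
Proof.
have zeroE on0 : @ECPoint F b None on0 = ec_zero b by exact: val_inj.
have class0 : point_class (ec_zero b) = principal 1 by [].
case: p => [[[x1 y1]|]] on1; last first.
  rewrite zeroE ec_add0 class0 ideal_mul1; first exact: point_class_opp.
  exact: point_class_ideal.
case: q => [[[x2 y2]|]] on2; last first.
  rewrite zeroE class0 (ideal_mulC _ (principal 1)) ideal_mul1.
    exact: (point_class_opp (ECPoint on1)).
  exact: (point_class_ideal (ECPoint on1)).
rewrite /point_class /=; case: ifPn => [/andP[/eqP -> /eqP ->]|nopp] /=.
  rewrite ideal_mulC ideal_mul1; last exact: ideal_mul_ideal.
  by rewrite ideal_mulC; apply: (point_class_opp (ECPoint on2)).
by apply: point_class_chord => //; apply/eqP.
Qed.

Lemma point_class_add p q : ideal_equiv (point_class (ec_add p q))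
  (ideal_mul (point_class p) (point_class q)).
Proof.
apply: ideal_equiv_cancel (point_class_collinear p q).
- exact: point_class_ideal.
- exact: ideal_mul_ideal.
- exact: point_class_opp.
Qed.

Lemma point_class_inj p q :
  ideal_equiv (point_class p) (point_class q) -> p = q.
Proof.
move=> Epq; apply/val_inj => /=.
have : ideal_equiv (point_class (ec_add p (ec_opp q))) (principal 1).
  apply: ideal_equiv_trans (point_class_add _ _) _.
  exact: ideal_equiv_trans (ideal_equiv_mulr _ Epq) (point_class_opp q).
rewrite /point_class.
case E: (ec_val (ec_add p (ec_opp q))) => [[x y]|].
  have /eqP on_xy : on_curve b (Some (x, y)) by rewrite -E; case: (ec_add _ _).
  by move/point_ideal_nprincipal; rewrite ec_poly_horner; case.
move: p q E {Epq} => [[[x1 y1]|]] on1 [[[x2 y2]|]] on2 //=.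
by case: ifP => //; rewrite opprK => /andP[/eqP -> /eqP ->].
Qed.

Lemma ec_addC : commutative (@ec_add F b).
Proof.
move=> p q; apply/point_class_inj/(ideal_equiv_trans (point_class_add _ _)).
by rewrite ideal_mulC; apply/ideal_equiv_sym/point_class_add.
Qed.

Lemma ec_addA : associative (@ec_add F b).
Proof.
move=> p q r; apply/point_class_inj/(ideal_equiv_trans (point_class_add _ _)).
apply: ideal_equiv_trans (ideal_equiv_mull _ (point_class_add _ _)) _.
rewrite ideal_mulA; apply: ideal_equiv_sym.
exact: ideal_equiv_trans (point_class_add _ _)
  (ideal_equiv_mulr _ (point_class_add _ _)).
Qed.

End GroupLaw.

Section ECGroup.

Variables (F : fieldType) (b : F) (b_smooth : ec_smooth b).

(* [ec_point b] is a group only for a nonsingular curve, hence this alias. *)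
Definition ec_group of ec_smooth b : Type := ec_point b.

Local Notation E := (ec_group b_smooth).

HB.instance Definition _ := [Equality of E by <:].
HB.instance Definition _ := [Choice of E by <:].
HB.instance Definition _ := GRing.isZmodule.Build E
  (ec_addA b_smooth) (ec_addC b_smooth) (@ec_add0 F b) (@ec_addN F b).

Lemma ec_addE (p q : E) : p + q = ec_add p q. Proof. by []. Qed.

Lemma ec_zmulE (m : int) (p : E) : ec_zmul m p = p *~ m.
Proof.
have iterE n : iter n (ec_add p) (ec_zero b) = p *+ n.
  by elim: n => //= n ->; rewrite mulrS.
by case: m => n; rewrite /ec_zmul iterE.
Qed.

End ECGroup.

(** * Independent points and ranks *)

Definition zindep (A : zmodType) (r : nat) (p : 'I_r -> A) : Prop :=
  forall m : 'I_r -> int, \sum_(i < r) p i *~ m i = 0 -> forall i, m i = 0.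

Lemma zindep_raddf (A B : zmodType) (f : {additive A -> B}) r (p : 'I_r -> A) :
  injective f -> zindep p -> zindep (f \o p).
Proof.
move=> f_inj p_indep m fp0; apply: p_indep; apply: f_inj.
rewrite raddf0 -fp0 raddf_sum; apply: eq_bigr => i _ /=; exact: raddfMz.
Qed.

Definition family_cat (T : Type) m n (p : 'I_m -> T) (q : 'I_n -> T)
    (i : 'I_(m + n)) : T :=
  match split i with inl j => p j | inr k => q k end.

Section Eigenvectors.

Variable A : zmodType.

Lemma zindep_mulrz2 r (p : 'I_r -> A) (m : 'I_r -> int) : zindep p ->
  (\sum_(i < r) p i *~ m i) *~ 2 = 0 -> forall i, m i = 0.
Proof.
move=> p_indep; rewrite mulrz_suml; under eq_bigr do rewrite -mulrzA.
by move=> /p_indep m2 i; have /eqP := m2 i; rewrite mulf_eq0 orbF => /eqP.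
Qed.

Lemma zindep_eigen_cat (s : {additive A -> A}) r t
    (p : 'I_r -> A) (q : 'I_t -> A) :
    (forall i, s (p i) = p i) -> (forall k, s (q k) = - q k) ->
  zindep p -> zindep q -> zindep (family_cat p q).
Proof.
move=> sp sq p_indep q_indep m; rewrite big_split_ord /=.
have catl i : family_cat p q (lshift t i) = p i.
  by rewrite /family_cat (unsplitK (inl _)).
have catr k : family_cat p q (rshift r k) = q k.
  by rewrite /family_cat (unsplitK (inr _)).
under eq_bigr do rewrite catl; under [X in _ + X]eq_bigr do rewrite catr.
set Sp := \sum_(i < r) _; set Sq := \sum_(k < t) _ => pq0.
have sSp : s Sp = Sp.
  by rewrite raddf_sum; apply: eq_bigr => i _; rewrite /= raddfMz sp.
have sSq : s Sq = - Sq.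
  rewrite raddf_sum -sumrN; apply: eq_bigr => k _.
  by rewrite /= raddfMz sq mulNrz.
have spq0 : Sp - Sq = 0 by rewrite -sSq -{1}sSp -raddfD pq0 raddf0.
have /(zindep_mulrz2 p_indep) m_l : Sp *~ 2 = 0.
  transitivity ((Sp + Sq) + (Sp - Sq)); last by rewrite pq0 spq0 addr0.
  by rewrite addrACA subrr addr0.
have /(zindep_mulrz2 q_indep) m_r : Sq *~ 2 = 0.
  transitivity ((Sp + Sq) - (Sp - Sq)); last by rewrite pq0 spq0 subrr.
  by rewrite opprB [Sp + Sq]addrC addrACA subrr addr0.
move=> i; rewrite -[i]splitK.
by case: (split i) => j; [apply: m_l | apply: m_r].
Qed.

(* On the span of P and tau P, (m - n tau)(m + n tau) is multiplication by
   m^2 + n^2. *)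
Lemma zindep_sqrtN1_orbit (tau : {additive A -> A}) (P : A) :
    tau (tau P) = - P -> (forall n, P *+ n.+1 <> 0) ->
  zindep (fun i : 'I_2 => iter i tau P).
Proof.
move=> tau2P P_ntors m; rewrite big_ord_recl big_ord1 /=.
set m0 := m _; set m1 := m _ => E0.
have E1 : tau P *~ m0 - P *~ m1 = 0.
  by have := congr1 tau E0; rewrite raddfD /= !raddfMz raddf0 tau2P mulNrz.
have : P *~ (m0 ^+ 2 + m1 ^+ 2) = 0.
  transitivity ((P *~ m0 + tau P *~ m1) *~ m0 - (tau P *~ m0 - P *~ m1) *~ m1).
    rewrite mulrzDr mulrzBl mulrzDl -!mulrzA opprB [m1 * m0]mulrC.
    by rewrite addrACA subrr addr0.
  by rewrite E0 E1 !mul0rz subrr.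
have -> : m0 ^+ 2 + m1 ^+ 2 = absz (m0 ^+ 2 + m1 ^+ 2) :> int.
  by rewrite gez0_abs // addr_ge0 ?sqr_ge0.
case E: `|_|%N => [|n]; last by move/P_ntors.
move=> _; move/eqP: E; rewrite absz_eq0 paddr_eq0 ?sqr_ge0 // !sqrf_eq0.
move=> /andP[/eqP m00 /eqP m10] i; case: (unliftP ord0 i) => [j|] -> //.
by rewrite (ord1 j).
Qed.

End Eigenvectors.

Lemma ec_indepE (F : fieldType) (b : F) (b_smooth : ec_smooth b) r
    (p : 'I_r -> ec_group b_smooth) : ec_indep p <-> zindep p.
Proof.
have sumE (m : 'I_r -> int) : \big[@ec_add F b/ec_zero b]_(i < r)
    ec_zmul (m i) (p i) = \sum_(i < r) p i *~ m i.
  by under eq_bigr do rewrite ec_zmulE.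
by split=> p_indep m; [rewrite -sumE | rewrite sumE]; apply: p_indep.
Qed.

Section ECMorphism.

Variables (F F' : fieldType) (phi : {rmorphism F -> F'}) (b : F) (b' : F').
Hypothesis phi_b : phi b = b'.

Definition ec_map_val (p : option (F * F)) : option (F' * F') :=
  if p is Some (x, y) then Some (phi x, phi y) else None.

Lemma ec_map_on_curve (p : ec_point b) : on_curve b' (ec_map_val (ec_val p)).
Proof.
case: p => [[[x y]|]] //= /eqP on_xy; rewrite -phi_b; apply/eqP.
by rewrite -rmorphXn on_xy; ring.
Qed.

Definition ec_map (p : ec_point b) : ec_point b' := ECPoint (ec_map_on_curve p).

Lemma ec_map_add p q : ec_map (ec_add p q) = ec_add (ec_map p) (ec_map q).
Proof.
apply: val_inj; case: p q => [[[x1 y1]|]] on1 [[[x2 y2]|]] on2 //=.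
rewrite -rmorphN !(inj_eq (fmorph_inj phi)); case: ifP => //= _.
have -> : ec_slope b' (phi x1) (phi y1) (phi x2) (phi y2) =
    phi (ec_slope b x1 y1 x2 y2).
  rewrite /ec_slope (inj_eq (fmorph_inj phi)) -phi_b.
  by case: ifP => _; rewrite fmorph_div; congr (_ / _); ring.
by congr (Some (_, _)); ring.
Qed.

Lemma ec_map_inj : injective ec_map.
Proof.
move=> [p on_p] [q on_q] /(congr1 (@ec_val _ _)) /= Epq; apply: val_inj => /=.
move: p q Epq {on_p on_q} => [[x1 y1]|] [[x2 y2]|] //=.
by case=> /fmorph_inj -> /fmorph_inj ->.
Qed.

Variables (b_smooth : ec_smooth b) (b'_smooth : ec_smooth b').

Definition ec_group_map (p : ec_group b_smooth) : ec_group b'_smooth :=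
  ec_map p.

Fact ec_group_map_zmod_morphism : zmod_morphism ec_group_map.
Proof.
move=> p q; apply/eqP; rewrite eq_sym subr_eq; apply/eqP.
by rewrite ec_addE -ec_map_add -(ec_addE (p - q) q) subrK.
Qed.

HB.instance Definition _ :=
  GRing.isZmodMorphism.Build _ _ ec_group_map ec_group_map_zmod_morphism.

End ECMorphism.

Lemma ec_smooth_map (F F' : fieldType) (phi : {rmorphism F -> F'}) (b : F) :
  ec_smooth (phi b) = ec_smooth b.
Proof.
by rewrite /ec_smooth -[in RHS](fmorph_eq0 phi); congr (_ != 0); ring.
Qed.

Lemma le_ec_rank_addn (F F' : fieldType) (b : F) (b' : F') (n : nat) :
    (forall r (p : 'I_r -> ec_point b), ec_indep p ->
       exists p' : 'I_(r + n) -> ec_point b', ec_indep p') ->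
  (ec_rank b + (Posz n)%:E <= ec_rank b')%E.
Proof.
move=> extend; rewrite /(ec_rank b').
case: pselect => [fin'|_]; last exact: leey.
case: (cid fin') => r' /= [_ max'].
have bound s (p : 'I_s -> ec_point b) : ec_indep p -> (s + n <= r')%N.
  by move=> /extend[p' /max'].
rewrite /ec_rank; case: pselect => [fin|nfin]; last first.
  case: nfin; pose indep s := `[< exists p : 'I_s -> ec_point b, ec_indep p >].
  have ex_indep : exists s, indep s.
    by exists 0%N; apply/asboolP; exists (fun _ => ec_zero b) => m _ [].
  have indep_le s : indep s -> (s <= r')%N.
    by move=> /asboolP[p /bound]; apply/leq_trans/leq_addr.
  case: (ex_maxnP ex_indep indep_le) => s /asboolP s_indep max_s.
  by exists s; split=> // t p p_indep; apply/max_s/asboolP; exists p.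
case: (cid fin) => r /= [[p p_indep] _].
by rewrite -EFinD lee_fin -PoszD lez_nat; apply: bound p_indep.
Qed.

Lemma le_ec_rank_add2 (F F' : fieldType) (phi : {rmorphism F -> F'})
    (tau : {rmorphism F' -> F'}) (b : F) (b_smooth : ec_smooth (phi b))
    (P : ec_group b_smooth) (x y : F') :
    (forall a, tau (phi a) = phi a) ->
    ec_val P = Some (x, y) -> tau (tau x) = x -> tau (tau y) = - y ->
    (forall n, P *+ n.+1 <> 0) ->
  (ec_rank b + (Posz 2)%:E <= ec_rank (phi b))%E.
Proof.
move=> tauK EP tau2x tau2y P_ntors; have b_smooth' := b_smooth.
rewrite ec_smooth_map in b_smooth'.
pose f : {additive ec_group b_smooth' -> _} := ec_group_map erefl b_smooth.
pose t : {additive ec_group b_smooth -> _} := ec_group_map (tauK b) b_smooth.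
have tf q : t (f q) = f q.
  by apply: val_inj; case: q => [[[xq yq]|]] on_q //=; rewrite !tauK.
have t2P : t (t P) = - P.
  by apply: val_inj; rewrite /= EP /= tau2x tau2y.
apply: le_ec_rank_addn => r p /(ec_indepE (b_smooth := b_smooth')) p_indep.
exists (family_cat (f \o p) (fun i : 'I_2 => iter i t P)).
apply/(ec_indepE (b_smooth := b_smooth)).
apply: (zindep_eigen_cat (s := t \o t)) => [i|k||].
- by rewrite /= !tf.
- by elim: (k : nat) => [|i /= ->]; [apply: t2P | apply: raddfN].
- by apply: zindep_raddf p_indep; apply: ec_map_inj.
- exact: zindep_sqrtN1_orbit.
Qed.

(** * Integrality at 2 *)

Lemma horner_map_coef_wide (aR rR : nzRingType) (f : {additive aR -> rR}) n
    (p : {poly aR}) (x : rR) : (size p <= n)%N ->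
  (map_poly f p).[x] = \sum_(i < n) f p`_i * x ^+ i.
Proof.
move=> le_pn; have le_fpn := leq_trans (size_poly _ (fun i => f p`_i)) le_pn.
by rewrite (horner_coef_wide _ le_fpn); apply: eq_bigr => i _; rewrite coef_map.
Qed.

Lemma integral_lead_coef (R : comNzRingType) (K : fieldType)
    (f : {rmorphism R -> K}) (p : {poly R}) (x : K) :
  root (map_poly f p) x -> integralOver f (f (lead_coef p) * x).
Proof.
have [/size1_polyC -> /rootP|n_gt1 /rootP px0] := leqP (size p) 1.
  rewrite map_polyC hornerC lead_coefC => ->.
  by rewrite mul0r; apply: integral0.
have [n Ep] : exists n, size p = n.+2.
  by case: (size p) n_gt1 => [|[|n]] // _; exists n.
set c := lead_coef p; pose q := \poly_(i < n.+1) (p`_i * c ^+ (n - i)).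
have size_q : (size q <= n.+1)%N by apply: size_poly.
exists ('X^(n.+1) + q).
  by rewrite monicE lead_coefDl ?lead_coefXn // size_polyXn ltnS.
apply/rootP; rewrite rmorphD /= map_polyXn hornerD hornerXn.
transitivity (f c ^+ n * (map_poly f p).[x]); last by rewrite px0 mulr0.
rewrite (horner_map_coef_wide _ _ size_q).
rewrite (@horner_map_coef_wide _ _ f n.+2) ?Ep // [in RHS]big_ord_recr mulrDr.
rewrite mulr_sumr [LHS]addrC /=.
congr (_ + _).
  apply: eq_bigr => i _; rewrite coef_poly ltn_ord rmorphM rmorphXn exprMn /=.
  have <- : f c ^+ (n - i) * f c ^+ i = f c ^+ n.
    by rewrite -exprD subnK ?leq_ord.
  by ring.
have <- : c = p`_n.+1 by rewrite /c lead_coefE Ep.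
by rewrite exprMn exprSr mulrA.
Qed.

(* 2^d p((X - n) / 2), where d is the degree of p. *)
Definition half_shift (p : {poly int}) (n : int) : {poly int} :=
  \sum_(i < size p) (p`_i * 2 ^+ ((size p).-1 - i)) *: ('X - n%:P) ^+ i.

Lemma horner_half_shift (F : fieldType) (p : {poly int}) (n : int) (a : F) :
  (map_poly intr (half_shift p n)).[n%:~R + 2 * a] =
    2 ^+ (size p).-1 * (map_poly intr p).[a].
Proof.
rewrite [in RHS](horner_map_coef_wide _ _ (leqnn _)) mulr_sumr.
rewrite rmorph_sum horner_sum.
apply: eq_bigr => i _; rewrite /= map_polyZ rmorphXn rmorphB /= map_polyX.
rewrite map_polyC hornerZ horner_exp !hornerE addrAC subrr add0r exprMn.
have <- : 2 ^+ ((size p).-1 - i) * 2 ^+ i = 2 ^+ (size p).-1 :> F.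
  by rewrite -exprD subnK // -ltnS (ltn_predK (ltn_ord i)).
by rewrite rmorphM rmorphXn /=; ring.
Qed.

Lemma odd_half_shift (p : {poly int}) (n : int) :
  p \is monic -> odd `|n| -> odd `|(half_shift p n).[0]|.
Proof.
move=> p_monic n_odd; rewrite /half_shift.
have [d Ep] : exists d, size p = d.+1.
  by exists (size p).-1; rewrite prednK // size_poly_gt0 monic_neq0.
have pd : p`_d = 1 by rewrite -(eqP p_monic) lead_coefE Ep.
rewrite Ep horner_sum big_ord_recr /= subnn mulr1 pd scale1r.
rewrite horner_exp !hornerE.
have odd_dvdz k : odd `|k| = ~~ (2 %| k)%Z by rewrite dvdzE dvdn2 negbK.
rewrite odd_dvdz rpredDl -?odd_dvdz.
  by rewrite abszX abszN oddX n_odd orbT.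
apply: rpred_sum => i _; rewrite hornerZ mulrAC dvdz_mull // -subSS subSn //.
by rewrite exprS dvdz_mulr.
Qed.

Section IntegralAt2.

Variable F : fieldType.
Implicit Types a u x y : F.

Local Notation integral := (integralOver (intr : int -> F)).

(* The constant term of 2^d p((X - n) / 2), which vanishes at n + 2 a when
   p(a) = 0, is odd when p is monic. *)
Lemma integral_odd_shift a (n : int) : integral a -> odd `|n| ->
  exists m s, [/\ odd `|m|, integral s & (n%:~R + 2 * a) * s = m%:~R].
Proof.
move=> int_a n_odd; have [p p_monic /rootP pa0] := int_a.
set u := n%:~R + 2 * a; pose P := half_shift p n.
have Pu0 : (map_poly intr P).[u] = 0 by rewrite horner_half_shift pa0 mulr0.
have /factor_theorem[S PS] : root (P - P.[0]%:P) 0.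
  by rewrite /root !hornerE subrr.
exists (P.[0]), (- (map_poly intr S).[u]); split; first exact: odd_half_shift.
  apply/integral_opp/integral_horner.
    by apply/integral_poly => i; rewrite coef_map; apply: integral_id.
  apply: integral_add; first exact: integral_id.
  by apply: integral_mul => //; apply: integral_nat.
move: PS => /(congr1 (fun q => (map_poly intr q).[u])).
rewrite rmorphB rmorphM rmorphB /= map_polyX !map_polyC rmorph0.
by rewrite !hornerE Pu0 sub0r subr0 mulrN mulrC => <-; rewrite opprK.
Qed.

(* The integral closure of Z localized at the prime 2. *)
Definition integral_at2 : {pred F} :=
  fun x => `[< exists n : int, odd `|n| /\ integral (n%:~R * x) >].

Lemma integral_at2P x :
  reflect (exists n : int, odd `|n| /\ integral (n%:~R * x))
    (x \in integral_at2).
Proof. exact: asboolP. Qed.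

Fact integral_at2_subring_closed : subring_closed integral_at2.
Proof.
have int_z n : integral n%:~R by apply: integral_id.
split=> [|x y|x y]; first by apply/integral_at2P; exists 1; rewrite mulr1.
  move=> /integral_at2P[n [n_odd int_nx]] /integral_at2P[m [m_odd int_my]].
  apply/integral_at2P; exists (n * m); rewrite abszM oddM n_odd; split=> //.
  have -> : (n * m)%:~R * (x - y) = m%:~R * (n%:~R * x) - n%:~R * (m%:~R * y).
    by ring.
  by apply: integral_sub; apply: integral_mul.
move=> /integral_at2P[n [n_odd int_nx]] /integral_at2P[m [m_odd int_my]].
apply/integral_at2P; exists (n * m); rewrite abszM oddM n_odd; split=> //.
have -> : (n * m)%:~R * (x * y) = (n%:~R * x) * (m%:~R * y) by ring.
exact: integral_mul.
Qed.

HB.instance Definition _ :=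
  GRing.isSubringClosed.Build F integral_at2 integral_at2_subring_closed.

Lemma integral_at2_root_nat n k x : x ^+ k.+1 = n%:R -> x \in integral_at2.
Proof.
move=> xk; apply/integral_at2P; exists 1; rewrite mul1r; split=> //.
exists ('X^(k.+1) - (n : int)%:P); first by rewrite monicXnsubC.
by rewrite rmorphB /= map_polyXn map_polyC /root !hornerE xk subrr.
Qed.

Definition unit_at2 : {pred F} :=
  [pred x | [&& x != 0, x \in integral_at2 & x^-1 \in integral_at2]].

Fact unit_at2_divr_closed : divr_closed unit_at2.
Proof.
split=> [|x y]; first by rewrite inE invr1 oner_neq0 rpred1.
rewrite !inE => /and3P[x0 Ox OVx] /and3P[y0 Oy OVy].
by rewrite mulf_neq0 ?invr_neq0 // invf_div !rpredM.
Qed.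

HB.instance Definition _ :=
  GRing.isDivClosed.Build F unit_at2 unit_at2_divr_closed.

Lemma unit_at2_integral e : e \in unit_at2 -> e \in integral_at2.
Proof. by case/and3P. Qed.

Hypothesis F_char0 : has_pchar0 F.

Lemma pchar0_natf_eq0 n : (n%:R == 0 :> F) = (n == 0)%N.
Proof. exact: (proj1 (pcharf0P F) F_char0). Qed.

Lemma pchar0_intr_eq0 (m : int) : (m%:~R == 0 :> F) = (m == 0).
Proof.
by case: m => n; rewrite ?NegzE ?mulrNz ?oppr_eq0 -pmulrn pchar0_natf_eq0.
Qed.

Lemma pchar0_odd_neq0 (m : int) : odd `|m| -> m%:~R != 0 :> F.
Proof. by rewrite pchar0_intr_eq0; apply: contraTneq => ->. Qed.

Lemma unit_at2_1D2 x : x \in integral_at2 -> 1 + 2 * x \in unit_at2.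
Proof.
move=> Ox; have /integral_at2P[n [n_odd int_nx]] := Ox.
have [m [s [m_odd int_s Em]]] := integral_odd_shift int_nx n_odd.
have m0 := pchar0_odd_neq0 m_odd.
have {}Em : (1 + 2 * x) * (n%:~R * s) = m%:~R by rewrite -Em; ring.
have x0 : 1 + 2 * x != 0.
  by apply: contra_neq m0 => x0; rewrite -Em x0 mul0r.
rewrite inE x0 rpredD ?rpredM ?rpred1 ?rpred_nat //=.
apply/integral_at2P; exists m; split=> //.
by rewrite -Em mulrC mulKf //; apply: integral_mul => //; apply: integral_id.
Qed.

Lemma half_notin_integral_at2 : 2^-1 \notin integral_at2.
Proof.
have n2 : 2 != 0 :> F by rewrite pchar0_natf_eq0.
apply/negP=> /integral_at2P[n [n_odd int_n2]].
have [|m [s [m_odd _]]] := integral_odd_shift int_n2 (n := - n).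
  by rewrite abszN.
rewrite mulrCA mulfV // mulr1 mulrNz addNr mul0r => /esym/eqP.
by rewrite (negbTE (pchar0_odd_neq0 m_odd)).
Qed.

Lemma four_exp_mul_neq1 n a : a \in integral_at2 -> 4 ^+ n.+1 * a != 1.
Proof.
move=> Oa; apply: contra half_notin_integral_at2 => /eqP E.
have n2 : 2 != 0 :> F by rewrite pchar0_natf_eq0.
have -> : 2^-1 = 2 * 4 ^+ n * a.
  apply: (mulfI n2); rewrite divff //.
  by transitivity (4 ^+ n.+1 * a); [rewrite E | rewrite exprS; ring].
by rewrite !rpredM ?rpredX ?rpred_nat.
Qed.

End IntegralAt2.

Arguments integral_at2 {F}.
Arguments unit_at2 {F}.

Lemma fieldExt_rat_pchar0 (K : fieldExtType rat) : has_pchar0 K.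
Proof. by move=> i; rewrite pchar_lalg pchar_num. Qed.

Lemma integral_at2_rmorph (F F' : fieldType) (phi : {rmorphism F -> F'}) x :
  x \in integral_at2 -> phi x \in integral_at2.
Proof.
move=> /integral_at2P[n [n_odd [p p_monic px0]]].
apply/integral_at2P; exists n; split=> //; exists p => //.
move: px0; rewrite -(fmorph_root phi) rmorphM rmorph_int -map_poly_comp.
by rewrite (eq_map_poly (rmorph_int phi)).
Qed.

Lemma integral_at2_scale (K : fieldExtType rat) (x : K) :
  exists k, 2 ^+ k * x \in integral_at2.
Proof.
have /polyOver1P[p0 Ep0] := minPolyOver 1 x.
have [p [a a0 Ep]] := rat_poly_scale p0.
have p_neq0 : p != 0.
  apply: contra_neq (monic_neq0 (monic_minPoly 1 x)) => p0'.
  by rewrite Ep0 Ep p0' rmorph0 scaler0 rmorph0.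
have px0 : root (map_poly intr p) x.
  have := root_minPoly 1 x; rewrite Ep0 Ep map_polyZ rootZ.
    by rewrite -map_poly_comp (eq_map_poly (rmorph_int (in_alg K))).
  by rewrite fmorph_eq0 invr_eq0 intr_eq0.
set c := lead_coef p.
have c_gt0 : (0 < `|c|)%N by rewrite absz_gt0 lead_coef_eq0.
have [m m_odd Ec] := pfactor_coprime (isT : prime 2) c_gt0.
set k := logn 2 `|c| in Ec; exists k; apply/integral_at2P; exists (sgz c * m).
split; first by rewrite abszM /= absz_sg lead_coef_eq0 p_neq0 mul1n -coprime2n.
have {}Ec : c = sgz c * (m * 2 ^ k)%N by rewrite -Ec -intEsg.
have -> : (sgz c * m)%:~R * (2 ^+ k * x) = c%:~R * x.
  by rewrite [in RHS]Ec !intrM -!pmulrn natrM natrX; ring.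
exact: integral_lead_coef.
Qed.

(** * Points of infinite order *)

Section Duplication.

Variables (F : fieldType) (b : F).
Implicit Types (u x y : F).

(* In terms of u = 1 / x, the duplication formula reads
   u(2 p) = 4 u (dup_num u / dup_den u). *)
Definition dup_num u : F := 1 + 2 * u + b * u ^+ 2 + 2 * b * u ^+ 3.
Definition dup_den u : F :=
  1 - 2 * b * u ^+ 2 - 16 * b * u ^+ 3 + (b ^+ 2 - 16 * b) * u ^+ 4.

Lemma ec_duplication (p : ec_point b) x y : 2 != 0 :> F ->
    ec_val p = Some (x, y) -> x != 0 -> dup_num x^-1 != 0 ->
  exists x' y', ec_val (ec_add p p) = Some (x', y') /\
    x'^-1 = 4 * (dup_num x^-1 / dup_den x^-1) * x^-1.
Proof.
move=> n2 Ep x0; set N := dup_num _; set D := dup_den _ => N0.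
have /eqP on_xy : on_curve b (Some (x, y)) by rewrite -Ep; case: (p).
have Ey2 : y ^+ 2 = x ^+ 3 * N by rewrite on_xy /N /dup_num; field.
have tangent2 : (3 * x ^+ 2 + 4 * x + b) ^+ 2 =
    x ^+ 4 * D + 8 * (1 + x) * (x ^+ 3 * N).
  by rewrite /D /dup_den /N /dup_num; field.
have y0 : y != 0 by rewrite -sqrf_eq0 Ey2 mulf_neq0 ?expf_neq0.
have y_nopp : (y == - y) = false.
  by apply/negbTE; rewrite -addr_eq0 -mulr2n -mulr_natl mulf_neq0.
have n4 : 4 != 0 :> F by rewrite (natrM _ 2 2) mulf_neq0.
rewrite /= Ep /= eqxx y_nopp /=; set x' := _ - x - x; set y' := _ - y.
exists x', y'; split=> //.
have -> : x' = x * D / (4 * N).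
  rewrite /x' /ec_slope eqxx exprMn tangent2 exprVn exprMn Ey2.
  by field; rewrite N0 n4.
by rewrite invf_div invfM; ring.
Qed.

Definition doubling_small u : Prop :=
  [/\ u != 0, u \in integral_at2
    & exists2 c, c \in integral_at2 & b * u ^+ 2 = 2 * c].

Lemma doubling_small_mul a u : a != 0 -> a \in integral_at2 ->
  doubling_small u -> doubling_small (a * u).
Proof.
move=> a0 Oa [u0 Ou [c Oc Ec]]; split; rewrite ?mulf_neq0 ?rpredM //.
exists (a ^+ 2 * c); first by rewrite rpredM ?rpredX.
by rewrite exprMn mulrCA Ec mulrCA.
Qed.

Hypothesis F_char0 : has_pchar0 F.

Lemma unit_at2_dup_num u : doubling_small u -> dup_num u \in unit_at2.
Proof.
move=> [_ Ou [c Oc Ec]].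
have -> : dup_num u = 1 + 2 * (u + c + 2 * c * u).
  transitivity (1 + 2 * u + b * u ^+ 2 + 2 * u * (b * u ^+ 2)).
    by rewrite /dup_num; ring.
  by rewrite Ec; ring.
by rewrite unit_at2_1D2 // !rpredD ?rpredM ?rpred_nat.
Qed.

Lemma unit_at2_dup_den u : doubling_small u -> dup_den u \in unit_at2.
Proof.
move=> [_ Ou [c Oc Ec]].
have -> : dup_den u =
    1 + 2 * (- (2 * c) - 16 * c * u + 2 * c ^+ 2 - 16 * c * u ^+ 2).
  transitivity (1 - 2 * (b * u ^+ 2) - 16 * (b * u ^+ 2) * u + (b * u ^+ 2) ^+ 2
    - 16 * (b * u ^+ 2) * u ^+ 2); first by rewrite /dup_den; ring.
  by rewrite Ec; ring.
by rewrite unit_at2_1D2 // !(rpredB, rpredD, rpredN) ?rpredM ?rpredX ?rpred_nat.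
Qed.

Variables (b_smooth : ec_smooth b) (p : ec_group b_smooth) (x y : F).
Hypothesis Ep : ec_val p = Some (x, y).
Hypothesis x_small : doubling_small x^-1.

Lemma ec_iter_doubling k : exists x' y' e,
  [/\ ec_val (p *+ 2 ^ k) = Some (x', y'), e \in unit_at2
    & x'^-1 = 4 ^+ k * e * x^-1].
Proof.
have n4 : 4 != 0 :> F by rewrite pchar0_natf_eq0.
elim: k => [|k [x1 [y1 [e [Ek Ue Ex1]]]]].
  by exists x, y, 1; rewrite expr0 !mul1r rpred1.
have [e0 Oe _] := and3P Ue.
have x1_small : doubling_small x1^-1.
  rewrite Ex1; apply: doubling_small_mul x_small.
    by rewrite mulf_neq0 ?expf_neq0.
  by rewrite rpredM ?rpredX ?rpred_nat.
have UN := unit_at2_dup_num x1_small; have [N0 _ _] := and3P UN.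
have [x1V0 _ _] := x1_small.
have [||x2 [y2 [E2 Ex2]]] := ec_duplication _ Ek _ N0.
- by rewrite pchar0_natf_eq0.
- by rewrite -invr_eq0.
exists x2, y2, (dup_num x1^-1 / dup_den x1^-1 * e); split.
- by rewrite expnS mulnC mulrnA mulr2n.
- by rewrite rpredM ?rpred_div ?unit_at2_dup_den.
- by rewrite Ex2 Ex1 exprS; ring.
Qed.

Lemma ec_mul_exp2_neq j k : p *+ 2 ^ j <> p *+ 2 ^ (j + k.+1).
Proof.
have n4 : 4 != 0 :> F by rewrite pchar0_natf_eq0.
have [x1 [y1 [e1 [E1 Ue1 Ex1]]]] := ec_iter_doubling j.
have [x2 [y2 [e2 [E2 Ue2 Ex2]]]] := ec_iter_doubling (j + k.+1).
have [e10 _ _] := and3P Ue1; have [xV0 _ _] := x_small.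
move=> Ejk; move: E2; rewrite -Ejk E1 => -[Ex _].
have /negP[] : 4 ^+ k.+1 * (e2 / e1) != 1.
  by apply: four_exp_mul_neq1 => //; apply/unit_at2_integral/rpred_div.
apply/eqP/(mulIf e10); rewrite mulrA divfK // mul1r.
apply: (mulfI (expf_neq0 j n4)); apply: (mulIf xV0).
by rewrite mulrA -exprD -Ex2 -Ex Ex1.
Qed.

End Duplication.

Lemma exp2_eventually_periodic n : (0 < n)%N ->
  exists j k, 2 ^ (j + k.+1) = 2 ^ j %[mod n].
Proof.
move=> n_gt0; have [m m_odd En] := pfactor_coprime (isT : prime 2) n_gt0.
set j := logn 2 n in En.
have m_gt0 : (0 < m)%N by case: m En m_odd n_gt0 => [->|].
exists j, (totient m).-1; rewrite prednK ?totient_gt0 //.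
apply/eqP; rewrite eqn_mod_dvd ?leq_exp2l ?leq_addr //.
rewrite expnD -[X in (_ - X)%N]muln1 -mulnBr {1}En mulnC dvdn_mul //.
by rewrite -eqn_mod_dvd ?expn_gt0 //; apply/eqP/Euler_exp_totient.
Qed.

Lemma doubling_small_ntors (F : fieldType) (b : F) (b_smooth : ec_smooth b)
    (p : ec_group b_smooth) (x y : F) : has_pchar0 F ->
    ec_val p = Some (x, y) -> doubling_small b x^-1 ->
  forall n, p *+ n.+1 <> 0.
Proof.
move=> F_char0 Ep x_small n pn0.
have [j [k Ejk]] := exp2_eventually_periodic (ltn0Sn n).
have mod_n i : p *+ i = p *+ (i %% n.+1).
  by rewrite {1}(divn_eq i n.+1) mulrnDr mulnC mulrnA pn0 mul0rn add0r.
apply: (ec_mul_exp2_neq F_char0 Ep x_small (j := j) (k := k)).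
by rewrite mod_n -Ejk -mod_n.
Qed.

(** * Primes that are not squares in a number field *)

Lemma nsquare_neq0 (F : fieldType) (a : F) :
  (forall x, x ^+ 2 != a) -> a != 0.
Proof. by move=> /(_ 0); rewrite expr0n eq_sym. Qed.

Lemma nsquare_mul_sqr (F : fieldType) (a g : F) : g != 0 ->
  (forall x, x ^+ 2 != a) -> forall x, x ^+ 2 != a * g ^+ 2.
Proof.
move=> g0 a_nsq x; apply: contra (a_nsq (x / g)) => /eqP E.
by rewrite expr_div_n E mulfK ?expf_neq0.
Qed.

Section QuadraticAdjoin.

Variables (F0 : fieldType) (N : fieldExtType F0) (F : {subfield N}) (s : N).
Hypothesis s2F : s ^+ 2 \in F.

Lemma mem_Fadjoin_sqrt t : t \in <<F; s>>%VS ->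
  exists x y, [/\ x \in F, y \in F & t = x + y * s].
Proof.
case/Fadjoin_polyP=> q /polyOverP qF ->; rewrite horner_coef.
apply: (big_ind (fun z => exists x y, [/\ x \in F, y \in F & z = x + y * s])).
- by exists 0, 0; rewrite !rpred0 mul0r addr0.
- move=> _ _ [x [y [xF yF ->]]] [x' [y' [xF' yF' ->]]].
  by exists (x + x'), (y + y'); split; rewrite ?rpredD //; ring.
- move=> i _; rewrite -[in s ^+ _](odd_double_half i) exprD -mul2n exprM.
  have cF : q`_i * (s ^+ 2) ^+ i./2 \in F.
    by apply: rpredM; [apply: qF | apply: rpredX].
  case: (odd i).
    by exists 0, (q`_i * (s ^+ 2) ^+ i./2); split; rewrite ?rpred0 //; ring.
  by exists (q`_i * (s ^+ 2) ^+ i./2), 0; split; rewrite ?rpred0 //; ring.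
Qed.

Lemma Fadjoin_sqrt_sqr t : 2 != 0 :> N -> s \notin F ->
  t \in <<F; s>>%VS -> t ^+ 2 \in F -> t \in F \/ t * s \in F.
Proof.
move=> n2 sNF /mem_Fadjoin_sqrt[x [y [xF yF ->]]] t2F.
have /eqP : x * y = 0.
  apply: contraNeq sNF => xy0; have xy2 : 2 * (x * y) != 0 by rewrite mulf_neq0.
  have -> : s = ((x + y * s) ^+ 2 - x ^+ 2 - y ^+ 2 * s ^+ 2) / (2 * (x * y)).
    by apply: (mulIf xy2); rewrite divfK //; ring.
  apply: rpred_div; last by apply: rpredM; [apply: rpred_nat | apply: rpredM].
  apply: rpredB; last by apply: rpredM => //; apply: rpredX.
  by apply: rpredB => //; apply: rpredX.
rewrite mulf_eq0 => /orP[] /eqP ->.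
  by right; rewrite add0r -mulrA -expr2 rpredM.
by left; rewrite mul0r addr0.
Qed.

End QuadraticAdjoin.

Lemma rat_sqr_even_logn p n (r : rat) : r ^+ 2 = n%:R -> ~~ odd (logn p n).
Proof.
move=> Er; have [->|n_gt0] := posnP n; first by rewrite logn0.
pose a := `|numq r|%N; pose d := `|denq r|%N.
have d_gt0 : (0 < d)%N by rewrite absz_gt0 denq_neq0.
have : (n * d ^ 2 = a ^ 2)%N.
  apply/eqP; rewrite -(eqr_nat rat) natrM !natrX -Er -exprMn.
  have -> : d%:R = (denq r)%:~R :> rat by rewrite -[denq r]absz_denq.
  rewrite /a natr_absz intr_norm real_normK ?num_real //.
  by rewrite -{1}[r]divq_num_den divfK // intr_eq0 denq_neq0.
move=> /(congr1 (logn p))/(congr1 odd); rewrite lognM ?expn_gt0 ?d_gt0 //.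
by rewrite !lognX oddD !oddM /= addbF => ->.
Qed.

Section NumberField.

Variable N : fieldExtType rat.

Definition nsquare_above (F : {vspace N}) (B : nat) : Prop :=
  forall p n t, prime p -> (B < p)%N -> odd (logn p n) -> t \in F ->
  t ^+ 2 != n%:R.

Lemma nsquare_above_rat : nsquare_above 1%VS 0.
Proof.
move=> p n t _ _ odd_n /vlineP[r ->]; apply: contraTneq odd_n.
rewrite exprZn expr1n -(rmorph_nat (in_alg N)) => /(fmorph_inj (in_alg N)).
exact: rat_sqr_even_logn.
Qed.

Lemma nsquare_above_adjoin (F : {subfield N}) B q (s : N) :
    nsquare_above F B -> prime q -> (B < q)%N -> s ^+ 2 = q%:R ->
  nsquare_above <<F; s>>%VS q /\ (\dim F < \dim <<F; s>>)%N.
Proof.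
move=> nsqF q_pr ltBq Es.
have n2 : 2 != 0 :> N by rewrite (pchar0_natf_eq0 (fieldExt_rat_pchar0 N)).
have s2F : s ^+ 2 \in F by rewrite Es rpred_nat.
have sNF : s \notin F.
  apply/negP=> sF; have odd_q : odd (logn q q) by rewrite logn_prime // eqxx.
  by have := nsqF q q s q_pr ltBq odd_q sF; rewrite Es eqxx.
split; last first.
  rewrite ltn_neqAle dimvS ?subv_adjoin // andbT.
  apply: contra sNF => /eqP dimE; have /eqP -> : F == <<F; s>>%AS :> {vspace N}.
    by rewrite eqEdim subv_adjoin dimE leqnn.
  exact: memv_adjoin.
move=> p n t p_pr ltqp odd_n tFs; apply/negP=> /eqP Et.
have t2F : t ^+ 2 \in F by rewrite Et rpred_nat.
have ltBp := ltn_trans ltBq ltqp.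
have [tF|tsF] := Fadjoin_sqrt_sqr s2F n2 sNF tFs t2F.
  by have := nsqF p n t p_pr ltBp odd_n tF; rewrite Et eqxx.
have odd_nq : odd (logn p (n * q)).
  have n_gt0 : (0 < n)%N by case: n odd_n {Et}; rewrite ?logn0.
  rewrite lognM ?(prime_gt0 q_pr) // (logn_prime p q_pr).
  by rewrite (gtn_eqF ltqp) addn0.
by have := nsqF p _ _ p_pr ltBp odd_nq tsF; rewrite exprMn Et Es natrM eqxx.
Qed.

(* If every prime were a square in N, then adjoining square roots of larger and
   larger primes would produce subfields of N of unbounded degree. *)
Lemma exists_prime_nsquare : exists2 p, prime p & forall s : N, s ^+ 2 != p%:R.
Proof.
apply: contrapT => no_p.
have sqrt_p p : prime p -> exists s : N, s ^+ 2 = p%:R.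
  move=> p_pr; apply: contrapT => no_s; apply: no_p; exists p => // s.
  by apply/eqP=> Es; apply: no_s; exists s.
suff /(_ (\dim {:N})) [F [B [lt _]]] : forall k, exists (F : {subfield N}) B,
    (k < \dim F)%N /\ nsquare_above F B.
  by move: lt; rewrite ltnNge dimvS ?subvf.
elim=> [|k [F [B [ltkF nsqF]]]].
  exists 1%AS, 0%N; split; first by rewrite adim_gt0.
  exact: nsquare_above_rat.
have [q ltBq q_pr] := prime_above B; have [s Es] := sqrt_p q q_pr.
have [nsqFs ltF] := nsquare_above_adjoin nsqF q_pr ltBq Es.
by exists <<F; s>>%AS, q; split=> //; apply: leq_ltn_trans ltkF ltF.
Qed.

End NumberField.

(** * Cyclic extensions *)

Section KummerRoots.

Variables (F : fieldType) (n : nat) (om z : F).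
Hypotheses (om_prim : n.-primitive_root om) (z_neq0 : z != 0).

Definition kummer_roots : seq F := [seq om ^+ i * z | i <- iota 0 n].

Lemma kummer_roots_uniq : uniq kummer_roots.
Proof.
rewrite map_inj_in_uniq ?iota_uniq // => i k; rewrite !mem_iota => i_lt k_lt.
move=> /(mulIf z_neq0)/eqP; rewrite (eq_prim_root_expr om_prim).
by rewrite !modn_small // => /eqP.
Qed.

Lemma kummer_factor :
  'X^n - (z ^+ n)%:P = \prod_(r <- kummer_roots) ('X - r%:P).
Proof.
have n_gt0 := prim_order_gt0 om_prim.
have -> : \prod_(r <- kummer_roots) ('X - r%:P) =
    lead_coef ('X^n - (z ^+ n)%:P) *: \prod_(r <- kummer_roots) ('X - r%:P).
  by rewrite lead_coefXnsubC // scale1r.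
apply: all_roots_prod_XsubC.
- by rewrite size_XnsubC // size_map size_iota.
- apply/allP=> _ /mapP[i _ ->]; rewrite /root !hornerE exprMn -exprM mulnC.
  by rewrite exprM (prim_expr_order om_prim) expr1n mul1r subrr.
- by rewrite uniq_rootsE kummer_roots_uniq.
Qed.

End KummerRoots.

Section Kummer.

Variables (K : fieldType) (n : nat) (om D : K).
Hypotheses (om_prim : n.-primitive_root om) (D_neq0 : D != 0).

Lemma kummer_root_neq0 (L : fieldExtType K) (z : L) : z ^+ n = D%:A -> z != 0.
Proof.
move=> zn; apply: contra_neq D_neq0 => z0; apply: (fmorph_inj (in_alg L)).
by rewrite rmorph0 /= -zn z0 expr0n gtn_eqF ?(prim_order_gt0 om_prim).
Qed.

Lemma kummer_factor_alg (L : fieldExtType K) (z : L) : z ^+ n = D%:A ->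
  'X^n - (D%:A)%:P = \prod_(r <- kummer_roots n om%:A z) ('X - r%:P) /\
  uniq (kummer_roots n om%:A z).
Proof.
move=> zn; have omL : n.-primitive_root (om%:A : L).
  by rewrite (fmorph_primitive_root (in_alg L)).
have z0 := kummer_root_neq0 zn.
by rewrite -zn; split; [apply: kummer_factor | apply: kummer_roots_uniq].
Qed.

Lemma kummer_polyOver (L : fieldExtType K) :
  'X^n - (D%:A)%:P \is a polyOver (1%VS : {vspace L}).
Proof. by rewrite rpredB ?rpredX ?polyOverX // polyOverC rpredZ ?rpred1. Qed.

Lemma kummer_splitting (L : fieldExtType K) (z : L) : z ^+ n = D%:A ->
    <<1; z>>%VS = fullv ->
  exists p : {poly L}, [/\ p \is a polyOver 1%VS, separable_poly p
    & splittingFieldFor 1 p {:L}].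
Proof.
move=> zn z_gen; have [E rs_uniq] := kummer_factor_alg zn.
exists ('X^n - (D%:A)%:P); split; first exact: kummer_polyOver.
  by rewrite E separable_prod_XsubC.
exists (kummer_roots n om%:A z); first by rewrite E eqpxx.
apply/eqP; rewrite eqEsubv subvf -z_gen /=.
apply/FadjoinP; rewrite sub1v seqv_sub_adjoin //.
have n_gt0 := prim_order_gt0 om_prim.
by apply/mapP; exists 0%N; rewrite ?mem_iota // expr0 mul1r.
Qed.

Variables (L : splittingFieldType K) (z : L).
Hypotheses (zn : z ^+ n = D%:A) (z_gen : <<1; z>>%VS = fullv).
Hypothesis dim_L : \dim {:L} = n.

Lemma kummer_galois : galois 1 {:L}.
Proof. by apply/splitting_galoisField; apply: kummer_splitting zn z_gen. Qed.

Lemma kummer_minPoly : minPoly 1 z = 'X^n - (D%:A)%:P.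
Proof.
have n_gt0 := prim_order_gt0 om_prim.
apply/eqP; rewrite -eqp_monic ?monic_minPoly ?monicXnsubC //.
have dvd_min : minPoly 1 z %| 'X^n - (D%:A)%:P.
  by apply: minPoly_dvdp (kummer_polyOver L) _; rewrite /root !hornerE zn subrr.
rewrite -(dvdp_size_eqp dvd_min) size_minPoly size_XnsubC //.
by rewrite adjoin_degreeE z_gen dim_L dimv1 divn1.
Qed.

Lemma kummer_gal_gen : exists2 tau : gal_of {:L},
  tau \in 'Gal({:L} / 1)%g & tau z = om%:A * z.
Proof.
have n_gt0 := prim_order_gt0 om_prim; have /and3P[_ _ nor] := kummer_galois.
apply: (normalField_root_minPoly (sub1v _) nor (memvf z)).
rewrite kummer_minPoly /root !hornerE exprMn exprZn expr1n.
by rewrite (prim_expr_order om_prim) scale1r mul1r zn subrr.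
Qed.

Lemma kummer_cyclic (tau : gal_of {:L}) : tau \in 'Gal({:L} / 1)%g ->
  tau z = om%:A * z -> 'Gal({:L} / 1)%g \isog Zp n.
Proof.
move=> gal_tau tauz; have card_gal : #|'Gal({:L} / 1)%g| = n.
  by rewrite -galois_dim ?kummer_galois // dim_L dimv1 divn1.
have tauK a : tau a%:A = a%:A.
  by apply: (fixed_gal (sub1v _) gal_tau); rewrite rpredZ ?rpred1.
have tauX k : (tau ^+ k)%g z = (om ^+ k)%:A * z.
  elim: k => [|k IHk]; first by rewrite expg0 gal_id scale1r mul1r.
  rewrite expgSr galM ?memvf // IHk rmorphM /= tauK tauz mulrA; congr (_ * z).
  by rewrite -scalerAl mul1r scalerA exprS mulrC.
have order_tau : #[tau]%g = n.
  apply/eqP; rewrite eqn_dvd -{1}card_gal order_dvdG //=.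
  rewrite (prim_order_dvd om_prim) -(inj_eq (fmorph_inj (in_alg L))) rmorph1 /=.
  rewrite -(inj_eq (mulIf (kummer_root_neq0 zn))) -tauX expg_order gal_id.
  by rewrite mul1r.
have -> : 'Gal({:L} / 1)%g = <[tau]>%g.
  apply/eqP; rewrite eq_sym eqEcard cycle_subG gal_tau card_gal /=.
  by rewrite -orderE order_tau.
by rewrite isog_sym; have := Zp_isog tau; rewrite order_tau.
Qed.

End Kummer.

Lemma sqrtN1_alg (K : fieldType) (L : fieldExtType K) (im : K) :
  im ^+ 2 = -1 -> (im%:A : L) ^+ 2 = -1.
Proof. by move=> im2; rewrite exprZn expr1n im2 scaleN1r. Qed.

Lemma sqrtN1_primitive (F : fieldType) (im : F) : 2 != 0 :> F ->
  im ^+ 2 = -1 -> 4.-primitive_root im.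
Proof.
move=> n2 im2; have N1_neq1 : (-1 == 1 :> F) = false.
  by apply/negbTE; rewrite eq_sym -addr_eq0.
have im1 : (im == 1) = false.
  by apply: contraFF N1_neq1 => /eqP im1; rewrite -im2 im1 expr1n.
have imN1 : (- im == 1) = false.
  by apply: contraFF N1_neq1 => /eqP imN1; rewrite -im2 -sqrrN imN1 expr1n.
apply/forallP=> -[[|[|[|[|//]]]] lt_i4] /=; rewrite unity_rootE ?expr1 ?im1 //.
- by rewrite im2 N1_neq1.
- by rewrite exprS im2 mulrN1 imN1.
- by rewrite -[4%N]/(2 * 2)%N exprM im2 sqrrN expr1n !eqxx.
Qed.

Lemma sqrtN1_C4_extension (K : fieldType) (im D : K) (L : splittingFieldType K)
    (z : L) : 2 != 0 :> K -> im ^+ 2 = -1 -> D != 0 -> z ^+ 4 = D%:A ->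
    <<1; z>>%VS = fullv -> \dim {:L} = 4 ->
  is_C4_extension L /\ exists tau : {rmorphism L -> L},
    (forall a, tau a%:A = a%:A) /\ tau z = im%:A * z.
Proof.
move=> n2 im2 D0 z4 z_gen dim4; have im_prim := sqrtN1_primitive n2 im2.
have [tau gal_tau tauz] := kummer_gal_gen im_prim D0 z4 z_gen dim4.
split.
  split; first exact: kummer_galois im_prim D0 _ _ z4 z_gen.
  exact: kummer_cyclic im_prim D0 _ _ z4 z_gen dim4 _ gal_tau tauz.
exists (tau : {rmorphism _ -> _}); split=> // a.
by apply: (fixed_gal (sub1v _) gal_tau); rewrite rpredZ ?rpred1.
Qed.

(** * Adjoining a fourth root *)

Lemma simple_extension (F Omega : fieldType) (j : {rmorphism F -> Omega})
    (p : {poly F}) (zeta : Omega) :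
    p != 0 -> root (map_poly j p) zeta ->
    (forall q, root (map_poly j q) zeta -> q != 0 -> (size p <= size q)%N) ->
  exists (L : fieldExtType F) (z : L) (iota : {rmorphism L -> Omega}),
    [/\ forall a, iota a%:A = j a, iota z = zeta, <<1; z>>%VS = fullv
      & \dim {:L} = (size p).-1].
Proof.
move=> p0 pz /(subfx_irreducibleP pz p0) irr.
exists (SubFieldExtType pz irr), (subfx_root j zeta p).
exists (@subfx_inj F Omega j zeta p : {rmorphism _ -> _}); split.
- exact: subfx_inj_base.
- exact: subfx_inj_root.
- apply/eqP; rewrite eqEsubv subvf; apply/subvP=> x _.
  have [q ->] := subfxEroot pz p0 x; apply: mempx_Fadjoin.
  by apply/polyOverP=> i; rewrite coef_map rpredZ ?rpred1.
- by rewrite dimvf.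
Qed.

Lemma Fadjoin1_horner (K : fieldType) (L : fieldExtType K) (z x : L) :
    <<1; z>>%VS = fullv ->
  exists2 q : {poly K},
    (size q <= \dim {:L})%N & x = (map_poly (in_alg L) q).[z].
Proof.
move=> z_gen; have [|q Eq] := @polyOver1P _ _ (Fadjoin_poly 1 z x) _.
  exact: Fadjoin_polyOver.
exists q; last by rewrite -Eq Fadjoin_poly_eq // z_gen memvf.
have := size_Fadjoin_poly 1 z x; rewrite Eq size_map_poly.
by rewrite adjoin_degreeE z_gen dimv1 divn1.
Qed.

Lemma horner_in_alg (K Omega : fieldType) (L : fieldExtType K)
    (sigma : {rmorphism K -> Omega}) (iota : {rmorphism L -> Omega})
    (q : {poly K}) (z : L) : (forall a, iota a%:A = sigma a) ->
  iota (map_poly (in_alg L) q).[z] = (map_poly sigma q).[iota z].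
Proof.
by move=> iotaK; rewrite -horner_map -map_poly_comp (eq_map_poly iotaK).
Qed.

Section QuarticIndependence.

Variables (F Omega : fieldType) (j : {rmorphism F -> Omega}).
Variables (im D : F) (zeta : Omega).
Hypothesis im2 : im ^+ 2 = -1.
Hypothesis D_nsq : forall x, x ^+ 2 != D.
Hypothesis zeta4 : zeta ^+ 4 = j D.

Lemma nsquare_sqr_eq x y : x ^+ 2 = y ^+ 2 * D -> x = 0 /\ y = 0.
Proof.
have [-> /eqP|y0 E] := eqVneq y 0.
  by rewrite expr0n mul0r sqrf_eq0 => /eqP.
by have := nsquare_mul_sqr y0 D_nsq x; rewrite E mulrC eqxx.
Qed.

Lemma sqrt_indep x y : j x + j y * zeta ^+ 2 = 0 -> x = 0 /\ y = 0.
Proof.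
move=> /eqP; rewrite addr_eq0 => /eqP E; apply: nsquare_sqr_eq.
apply: (fmorph_inj j); rewrite rmorphM !rmorphXn E sqrrN exprMn -exprM.
by rewrite [(zeta ^+ _)]zeta4.
Qed.

(* With w = zeta^2 and a + b w = - (c + d w) zeta, taking norms to F of the
   squares gives N(a + b w)^2 = - D N(c + d w)^2, and -1 is a square. *)
Lemma quartic_indep a b c d :
    j a + j b * zeta ^+ 2 = - ((j c + j d * zeta ^+ 2) * zeta) ->
  [/\ a = 0, b = 0, c = 0 & d = 0].
Proof.
move=> rel.
have [ab_cd ab_cd'] : a ^+ 2 + b ^+ 2 * D - 2 * c * d * D = 0 /\
    2 * a * b - (c ^+ 2 + d ^+ 2 * D) = 0.
  apply: sqrt_indep.
  transitivity ((j a + j b * zeta ^+ 2) ^+ 2 -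
    ((j c + j d * zeta ^+ 2) * zeta) ^+ 2); last by rewrite rel sqrrN subrr.
  transitivity (j a ^+ 2 + j b ^+ 2 * j D - 2 * j c * j d * j D +
    (2 * j a * j b - (j c ^+ 2 + j d ^+ 2 * j D)) * zeta ^+ 2); first by ring.
  by rewrite -zeta4; ring.
have norms : (a ^+ 2 - b ^+ 2 * D) ^+ 2 = (im * (c ^+ 2 - d ^+ 2 * D)) ^+ 2 * D.
  transitivity ((2 * c * d * D) ^+ 2 - D * (c ^+ 2 + d ^+ 2 * D) ^+ 2).
    by rewrite -(subr0_eq ab_cd) -(subr0_eq ab_cd'); ring.
  by rewrite [(im * _) ^+ 2]exprMn im2; ring.
have im0 : im != 0 by rewrite -sqrf_eq0 im2 oppr_eq0 oner_eq0.
have [/subr0_eq/nsquare_sqr_eq[-> ->] /eqP] := nsquare_sqr_eq norms.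
by rewrite mulf_eq0 (negbTE im0) => /eqP/subr0_eq/nsquare_sqr_eq[-> ->].
Qed.

Lemma quartic_root_eq0 (q : {poly F}) :
  (size q <= 4)%N -> root (map_poly j q) zeta -> q = 0.
Proof.
move=> le_q4 /rootP; rewrite (horner_map_coef_wide _ _ le_q4).
rewrite !big_ord_recr big_ord0 /= => qz0.
have [|q0 q2 q1 q3] := @quartic_indep q`_0 q`_2 q`_1 q`_3.
  by apply/eqP; rewrite -addr_eq0 -qz0; apply/eqP; ring.
apply/polyP=> -[|[|[|[|i]]]]; rewrite coef0 //.
exact/nth_default/(leq_trans le_q4).
Qed.

Lemma quartic_extension :
  exists (L : fieldExtType F) (z : L) (iota : {rmorphism L -> Omega}),
    [/\ forall a, iota a%:A = j a, iota z = zeta, <<1; z>>%VS = fullv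
      & \dim {:L} = 4].
Proof.
have size_p : size ('X^4 - D%:P) = 5 by rewrite size_XnsubC.
have [|||L [z [iota [iotaK iotaz z_gen dimL]]]] :=
    @simple_extension _ _ j ('X^4 - D%:P) zeta.
- by rewrite -size_poly_eq0 size_p.
- by rewrite rmorphB /= map_polyXn map_polyC /root !hornerE zeta4 subrr.
- move=> q qz; rewrite size_p; apply: contraNT; rewrite -leqNgt => le_q4.
  by rewrite (quartic_root_eq0 le_q4 qz).
by exists L, z, iota; rewrite dimL size_p.
Qed.

End QuarticIndependence.

(** * Linear disjointness *)

Lemma linearly_disjointS (Omega : fieldType) (k A B B' : set Omega) :
  (B `<=` B')%classic -> linearly_disjoint k A B' -> linearly_disjoint k A B.
Proof.
by move=> BB' disj n a Aa a_indep c Bc; apply: disj => // i; apply: BB'.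
Qed.

Lemma horner_rVpoly_mulmx (F Omega : fieldType) (f : {rmorphism F -> Omega}) n d
    (u : 'rV[F]_n) (M : 'M[F]_(n, d)) (zeta : Omega) :
  (map_poly f (rVpoly (u *m M))).[zeta] =
    \sum_i f (u 0 i) * (map_poly f (rVpoly (row i M))).[zeta].
Proof.
rewrite mulmx_sum_row linear_sum rmorph_sum horner_sum; apply: eq_bigr => i _.
by rewrite linearZ /= map_polyZ hornerZ.
Qed.

Lemma linearly_disjoint_horner (K N Omega : fieldType)
    (kappa : {rmorphism K -> N}) (sigma : {rmorphism K -> Omega})
    (j : {rmorphism N -> Omega}) (A : set Omega) (zeta : Omega) (d : nat) :
    (forall a, j (kappa a) = sigma a) ->
    (forall x, A x -> exists2 q : {poly K},
       (size q <= d)%N & x = (map_poly sigma q).[zeta]) ->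
    (forall q : {poly N},
       (size q <= d)%N -> root (map_poly j q) zeta -> q = 0) ->
  linearly_disjoint (range sigma) A (range j).
Proof.
move=> j_kappa A_horner zeta_indep n a Aa a_indep c jc ca0.
have [q size_q Ea] := fin_all_exists2 (fun i => A_horner _ (Aa i)).
have [c' _ Ec] := fin_all_exists2 jc.
pose M : 'M[K]_(n, d) := \matrix_i poly_rV (q i).
have rowM i : rVpoly (row i M) = q i by rewrite rowK poly_rV_K.
have M_free : row_free M.
  apply: inj_row_free => u uM0; apply/rowP=> i; rewrite mxE.
  apply: (fmorph_inj sigma); rewrite rmorph0.
  apply: (a_indep (fun i => sigma (u 0 i))) => [l|]; first by exists (u 0 l).
  have := horner_rVpoly_mulmx sigma u M zeta.
  rewrite uM0 linear0 rmorph0 horner0 => sum0; rewrite [RHS]sum0.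
  by apply: eq_bigr => l _; rewrite rowM Ea.
pose v : 'rV[N]_n := \row_i c' i.
have vM0 : v *m map_mx kappa M = 0.
  apply: (can_inj rVpolyK); rewrite linear0; apply: zeta_indep.
    exact: size_poly.
  apply/rootP; rewrite horner_rVpoly_mulmx -[RHS]ca0; apply: eq_bigr => i _.
  rewrite -map_row -map_rVpoly rowM mxE Ec Ea -map_poly_comp.
  by rewrite (eq_map_poly j_kappa).
have /row_free_inj v_inj : row_free (map_mx kappa M) by rewrite row_free_map.
have /rowP v0 : v = 0 by apply: v_inj; rewrite vM0 mul0mx.
by move=> i; have := v0 i; rewrite !mxE -Ec => ->; rewrite rmorph0.
Qed.

Lemma generated_subfield_sub (F Omega : fieldType) (j : {rmorphism F -> Omega})
    (X : set Omega) :
  (X `<=` range j -> generated_subfield X `<=` range j)%classic.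
Proof.
move=> subX x /(_ [pred y | `[< range j y >]]) gen; apply/asboolP; apply: gen.
  split; [|move=> _ _ /asboolP[y _ <-] /asboolP[z _ <-] ..]; apply/asboolP.
  - by exists 1; rewrite ?rmorph1.
  - by exists (y - z); rewrite ?rmorphB.
  - by exists (y / z); rewrite ?fmorph_div.
by move=> y Xy; apply/asboolP/subX.
Qed.

(** * The extensions and their points *)

Definition c4_quadratic (F : fieldType) (b v : F) : F :=
  v ^+ 2 + (2 + b) * v + 1.

Lemma unit_at2_c4_quadratic (F : fieldType) (b v a c : F) : has_pchar0 F ->
    a \in integral_at2 -> c \in integral_at2 -> v = 2 * a -> v * b = 2 * c ->
  c4_quadratic b v \in unit_at2.
Proof.
move=> F_char0 Oa Oc va vb.
have -> : c4_quadratic b v = 1 + 2 * (2 * a ^+ 2 + 2 * a + c).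
  transitivity (v ^+ 2 + 2 * v + v * b + 1).
    by rewrite /c4_quadratic; ring.
  by rewrite vb va; ring.
by rewrite unit_at2_1D2 // !rpredD ?rpredM ?rpredX ?rpred_nat.
Qed.

Section QuarticPoint.

Variables (F : fieldType) (b w z : F).
Hypothesis w_neq0 : w != 0.

Definition c4_point_x : F := w + w^-1.
Definition c4_point_y : F := (1 + w) * z / w ^+ 2.

Lemma c4_point_on_curve : z ^+ 2 = c4_quadratic b (w ^+ 2) * w ->
  on_curve b (Some (c4_point_x, c4_point_y)).
Proof.
move=> Ez; apply/eqP; rewrite /c4_point_y /c4_point_x !exprMn Ez.
by rewrite /c4_quadratic; field.
Qed.

Lemma c4_point_small (a c : F) : has_pchar0 F -> w \in integral_at2 ->
    a \in integral_at2 -> c \in integral_at2 ->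
    w ^+ 2 = 2 * a -> w ^+ 2 * b = 2 * c ->
  doubling_small b c4_point_x^-1.
Proof.
move=> F_char0 Ow Oa Oc w2a w2b.
have /and3P[w21 _ OVw21] : 1 + w ^+ 2 \in unit_at2.
  by rewrite w2a unit_at2_1D2.
have -> : c4_point_x^-1 = w / (1 + w ^+ 2).
  by rewrite -invf_div /c4_point_x; congr _^-1; field.
split; rewrite ?mulf_neq0 ?invr_neq0 ?rpredM //.
exists (c * (1 + w ^+ 2)^-1 ^+ 2); first by rewrite rpredM ?rpredX.
by rewrite exprMn mulrCA !mulrA w2b.
Qed.

End QuarticPoint.

Lemma le_ec_rank_C4 (K : fieldType) (L : fieldExtType K) (b im c : K) (n : nat)
    (z : L) (tau : {rmorphism L -> L}) (v := (2 * n.+1)%:R : K) :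
    has_pchar0 K -> ec_smooth b -> im ^+ 2 = -1 ->
    c \in integral_at2 -> v * b = 2 * c ->
    z ^+ 4 = (v * c4_quadratic b v ^+ 2)%:A ->
    (forall a : K, tau a%:A = a%:A) -> tau z = im%:A * z ->
  (ec_rank b + (Posz 2)%:E <= ec_rank (b%:A : L))%E.
Proof.
move=> K_char0 b_smooth im2 Oc vb z4 tauK tauz; pose g := c4_quadratic b v.
pose phi : {rmorphism K -> L} := in_alg L.
have L_char0 : has_pchar0 L by move=> i; rewrite pchar_lalg K_char0.
have v2n : v = 2 * n.+1%:R by rewrite /v natrM.
have g0 : phi g != 0.
  rewrite fmorph_eq0.
  have On : (n.+1%:R : K) \in integral_at2 by apply: rpred_nat.
  by case/and3P: (unit_at2_c4_quadratic K_char0 On Oc v2n vb).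
have tau2z : tau (tau z) = - z.
  by rewrite tauz rmorphM tauK /= tauz mulrA -expr2 sqrtN1_alg // mulN1r.
have [w [Ez w2 tau2w]] : exists w : L,
    [/\ z ^+ 2 = phi g * w, w ^+ 2 = phi v & tau (tau w) = w].
  exists (z ^+ 2 / phi g); split; first by rewrite mulrC divfK.
    rewrite exprMn -exprM z4 -/g exprVn -[_%:A]/(phi _) rmorphM rmorphXn.
    by rewrite mulfK ?expf_neq0.
  by rewrite !fmorph_div !rmorphXn /= !tauK tau2z sqrrN.
have w0 : w != 0 by rewrite -sqrf_eq0 w2 fmorph_eq0 pchar0_natf_eq0.
have on_P : on_curve (phi b) (Some (c4_point_x w, c4_point_y w z)).
  apply: c4_point_on_curve => //; rewrite Ez w2; congr (_ * _).
  by rewrite /g /c4_quadratic; ring.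
have bL_smooth : ec_smooth (phi b) by rewrite ec_smooth_map.
pose P : ec_group bL_smooth := ECPoint on_P.
apply: (@le_ec_rank_add2 _ _ phi tau b bL_smooth P _ _ tauK erefl).
- by rewrite /c4_point_x !(rmorphD, fmorphV) tau2w.
- rewrite /c4_point_y !(rmorphM, fmorphV, rmorphXn, rmorphD, rmorph1) /=.
  by rewrite tau2w tau2z mulrN mulNr.
apply: (doubling_small_ntors L_char0 (erefl : ec_val P = _)).
apply: (c4_point_small w0 L_char0 (a := n.+1%:R) (c := phi c)).
- by apply: (@integral_at2_root_nat _ (2 * n.+1) 1); rewrite w2 rmorph_nat.
- exact: rpred_nat.
- exact: integral_at2_rmorph.
- by rewrite w2 v2n; ring.
- by rewrite w2 -rmorphM vb; ring.
Qed.

Section Construction.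

Variable K : fieldExtType rat.

Lemma exists_even_nsquare (N : fieldExtType K) (b : K) :
  exists n, (exists2 c, c \in integral_at2 & (2 * n.+1)%:R * b = 2 * c) /\
    forall y : N, y ^+ 2 != (2 * n.+1)%:R.
Proof.
have [k Ob] := integral_at2_scale b.
have [p p_pr p_nsq] := exists_prime_nsquare (baseFieldType N).
have [n Ev] : exists n, (2 * n.+1 = p * (2 ^ k.+1) ^ 2)%N.
  exists (p * 2 ^ k * 2 ^ k.+1).-1; rewrite prednK.
    by rewrite -[((2 ^ _) ^ 2)%N]mulnn expnS; ring.
  by rewrite !muln_gt0 prime_gt0 // !expn_gt0.
exists n; rewrite Ev; split.
  exists (p%:R * 2 ^+ k.+1 * (2 ^+ k * b)).
    by rewrite rpredM // rpredM ?rpredX ?rpred_nat.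
  by rewrite natrM !natrX !exprS expr0; ring.
move=> y; rewrite natrM natrX; apply: nsquare_mul_sqr p_nsq y.
rewrite natrX expf_neq0 //.
by rewrite (pchar0_natf_eq0 (fieldExt_rat_pchar0 (baseFieldType N)) 2).
Qed.

Variables (b im : K) (b_smooth : ec_smooth b) (im2 : im ^+ 2 = -1).
Variables (Omega : closedFieldType) (sigma : {rmorphism K -> Omega}).

Record embedded_ext := EmbeddedExt {
  ext_field : fieldExtType K;
  ext_inj : {rmorphism ext_field -> Omega};
  ext_inj_alg : forall a, ext_inj a%:A = sigma a
}.

Record C4_layer := C4Layer {
  layer_field : splittingFieldType K;
  layer_inj : {rmorphism layer_field -> Omega};
  layer_sup : embedded_ext
}.

Lemma exists_fourth_root (D : K) : exists zeta : Omega, zeta ^+ 4 = sigma D.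
Proof.
have /closed_rootP[zeta] : size ('X^4 - (sigma D)%:P) != 1%N.
  by rewrite size_XnsubC.
by rewrite /root !hornerE subr_eq0 => /eqP zeta4; exists zeta.
Qed.

Lemma exists_quartic_sup (N : embedded_ext) (D : K) (zeta : Omega) :
    (forall y : ext_field N, y ^+ 2 != D%:A) -> zeta ^+ 4 = sigma D ->
  exists2 N' : embedded_ext, (range (ext_inj N) `<=` range (ext_inj N'))%classic
    & range (ext_inj N') zeta.
Proof.
move=> D_nsq zeta4; rewrite -(ext_inj_alg N) in zeta4.
have [N' [z' [j' [j'K j'z _ _]]]] :=
  quartic_extension (sqrtN1_alg _ im2) D_nsq zeta4.
have j'_alg a : j' (a%:A : baseFieldType N') = sigma a.
  by rewrite -(ext_inj_alg N) -j'K.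
exists (@EmbeddedExt (baseFieldType N') j' j'_alg); last by exists z'.
by move=> _ [y _ <-]; exists y%:A; rewrite ?j'K.
Qed.

Lemma exists_C4_extension (D : K) (zeta : Omega) :
    (forall x : K, x ^+ 2 != D) -> zeta ^+ 4 = sigma D ->
  exists (L : splittingFieldType K) (iota : {rmorphism L -> Omega}),
    [/\ forall a, iota a%:A = sigma a, is_C4_extension L,
        forall x, range iota x -> exists2 q : {poly K},
          (size q <= 4)%N & x = (map_poly sigma q).[zeta]
      & exists (z : L) (tau : {rmorphism L -> L}),
          [/\ z ^+ 4 = D%:A, forall a, tau a%:A = a%:A & tau z = im%:A * z]].
Proof.
move=> D_nsq zeta4; have D0 := nsquare_neq0 D_nsq.
have n2 : 2 != 0 :> K by rewrite (pchar0_natf_eq0 (fieldExt_rat_pchar0 K)).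
have [L [z [iota [iotaK iotaz z_gen dimL]]]] :=
  quartic_extension im2 D_nsq zeta4.
have z4 : z ^+ 4 = D%:A.
  by apply: (fmorph_inj iota); rewrite rmorphXn iotaz zeta4 iotaK.
have L_splitting : splitting_field_axiom L.
  have [p [p_over _ p_split]] :=
    kummer_splitting (sqrtN1_primitive n2 im2) D0 z4 z_gen.
  by exists p.
pose SL : splittingFieldType K :=
  HB.pack L (FieldExt_isSplittingField.Build K L L_splitting).
have [C4_L [tau [tauK tauz]]] :=
  sqrtN1_C4_extension (L := SL) n2 im2 D0 z4 z_gen dimL.
exists SL, iota; split=> //; last by exists z, tau.
move=> _ [x _ <-]; have [q size_q ->] := Fadjoin1_horner x z_gen.
rewrite dimL in size_q; exists q => //.
by rewrite (horner_in_alg _ _ iotaK) iotaz.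
Qed.

Definition layer_over (N : embedded_ext) (l : C4_layer) : Prop :=
  [/\ forall a : K, layer_inj l a%:A = sigma a,
      is_C4_extension (layer_field l),
      linearly_disjoint (range sigma) (range (layer_inj l)) (range (ext_inj N)),
      (ec_rank b + (Posz 2)%:E <= ec_rank (b%:A : layer_field l))%E
    & (range (ext_inj N) `|` range (layer_inj l) `<=`
         range (ext_inj (layer_sup l)))%classic].

Lemma exists_layer_over N : exists l, layer_over N l.
Proof.
have K_char0 := fieldExt_rat_pchar0 K.
have [n [[c Oc vb] v_nsqN]] := exists_even_nsquare (ext_field N) b.
set v := (2 * n.+1)%N in vb v_nsqN.
pose g := c4_quadratic b v%:R; pose D := v%:R * g ^+ 2.
have g0 : g != 0.
  have On : (n.+1%:R : K) \in integral_at2 by apply: rpred_nat.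
  have Ev : v%:R = 2 * n.+1%:R :> K by rewrite natrM.
  by case/and3P: (unit_at2_c4_quadratic K_char0 On Oc Ev vb).
have D_nsqN (y : ext_field N) : y ^+ 2 != D%:A.
  rewrite -[_%:A]/(in_alg _ D) rmorphM rmorphXn rmorph_nat.
  by apply: nsquare_mul_sqr v_nsqN y; rewrite fmorph_eq0.
have D_nsq x : x ^+ 2 != D.
  by apply: contra (D_nsqN x%:A) => /eqP <-; rewrite exprZn expr1n.
have [zeta zeta4] := exists_fourth_root D.
have [L [iota [iotaK C4_L L_horner [z [tau [z4 tauK tauz]]]]]] :=
  exists_C4_extension D_nsq zeta4.
have [N' subN [z' _ Ez']] := exists_quartic_sup D_nsqN zeta4.
exists (@C4Layer L iota N'); split=> //.
- apply: (linearly_disjoint_horner (kappa := in_alg (ext_field N))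
    (ext_inj_alg N) L_horner) => q.
  apply: (quartic_root_eq0 (sqrtN1_alg _ im2) D_nsqN).
  by rewrite (ext_inj_alg N).
- exact: le_ec_rank_C4 K_char0 b_smooth im2 Oc vb z4 tauK tauz.
- move=> y [/subN //|/L_horner[q _ ->]].
  exists (map_poly (in_alg _) q).[z'] => //.
  by rewrite (horner_in_alg _ _ (ext_inj_alg N')) Ez'.
Qed.

Fact regular_inj_alg (a : K) : sigma (a%:A : K^o) = sigma a.
Proof. by congr (sigma _); apply: mulr1. Qed.

Definition base_ext : embedded_ext :=
  @EmbeddedExt K^o sigma regular_inj_alg.

Variable next : embedded_ext -> C4_layer.
Hypothesis nextP : forall N, layer_over N (next N).

Definition layer_tower (n : nat) : embedded_ext :=
  iter n (fun N => layer_sup (next N)) base_ext.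

Lemma layer_sub_tower i n : (i < n)%N ->
  (range (layer_inj (next (layer_tower i))) `<=`
     range (ext_inj (layer_tower n)))%classic.
Proof.
elim: n => // n IHn; rewrite ltnS leq_eqVlt => /orP[/eqP ->|/IHn sub_n] x Lx;
  have [_ _ _ _ sub_next] := nextP (layer_tower n); apply: sub_next.
  by right.
by left; apply: sub_n.
Qed.

End Construction.

Theorem theorem1p3 (K : fieldExtType rat) (b : K)
    (b_neq0 : b <> 0) (b_neqN4 : b <> -4%:R)
    (sqrtN1 : exists z : K, z ^+ 2 = -1)
    (Omega : closedFieldType) (sigma : {rmorphism K -> Omega}) :
  exists (L : nat -> splittingFieldType K)
         (iota : forall i, {rmorphism L i -> Omega}),
    [/\ forall i (x : K), iota i x%:A = sigma x,
        forall i, is_C4_extension (L i),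
        linearly_disjoint_seq (range sigma) (fun i => range (iota i))
      & forall i, (ec_rank b + (Posz 2)%:E <= ec_rank (b%:A : L i))%E].
Proof.
have [im im2] := sqrtN1.
have b_smooth : ec_smooth b.
  apply/ec_smoothP; split; last by rewrite addr_eq0; apply/eqP.
    by rewrite (pchar0_natf_eq0 (fieldExt_rat_pchar0 K)).
  exact/eqP.
have [next nextP] := choice (exists_layer_over b_smooth im2 (sigma := sigma)).
pose N n := layer_tower next n.
exists (fun n => layer_field (next (N n))), (fun n => layer_inj (next (N n))).
split=> n; try by have [] := nextP (N n).
have [_ _ disj _ _] := nextP (N n); apply: linearly_disjointS disj.
apply: generated_subfield_sub => x [[a _ <-]|[i [lt_in Lx]]].
  by rewrite -(ext_inj_alg (N n)); exists a%:A.
exact: layer_sub_tower nextP _ _ lt_in _ Lx.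
Qed.
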